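(* Let $w$ be a weight on the unit disc $\mathbb{D}$ such that $0<w(0)<\infty$. Consider the following conditions: (a) $w$ is almost constant on top halves. (b) $w$ has the reverse Hölder property. (c) $w$ has the reverse Jensen property. (d) $w\in B_p$ for some $1<p<\infty$. (e) $w\in B_\infty$. If $w$ is increasing, then conditions (b), (c), (d), (e) are equivalent. If $w$ is decreasing, then conditions (a), (b), (c), (d) are equivalent.
   Context: $\mathbb{D}=\{z\in\mathbb{C}:|z|<1\}$ carries normalized area measure and $\mathbb{T}=\{|z|=1\}$ carries normalized arc length measure; $|\cdot|$ denotes these measures. $I\subset\mathbb{T}$ always means that $I$ is an interval (arc) of $\mathbb{T}$ of positive length, possibly all of $\mathbb{T}$. The Carleson square of $I$ is $Q_I=\{z\in\mathbb{D}\setminus\{0\}: z/|z|\in I,\ 1-|z|<|I|\}$ and its top half is $T_I=\{z\in\mathbb{D}\setminus\{0\}: z/|z|\in I,\ |I|/2<1-|z|<|I|\}$. For measurable $f$ on $\mathbb{D}$, $Mf(z)=\sup_{I\subset\mathbb{T}:\,z\in Q_I}\frac{1}{|Q_I|}\int_{Q_I}|f|$. A weight on $\mathbb{D}$ is a measurable $w:\mathbb{D}\to[0,\infty]$ with $0<w<\infty$ a.e. For an integrable weight $w$ (the classes below consist of integrable weights only): - $w\in B_p$ ($1<p<\infty$) if there is $C>0$ with $\left(\frac1{|Q_I|}\int_{Q_I}w\right)\left(\frac1{|Q_I|}\int_{Q_I}w^{1-p'}\right)^{p-1}\le C$ for all $I\subset\mathbb{T}$, where $p'=p/(p-1)$.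 - $w$ has the reverse Jensen property if there is $C>0$ with $\frac1{|Q_I|}\int_{Q_I}w\le C\exp\left(\frac1{|Q_I|}\int_{Q_I}\log w\right)$ for all $I\subset\mathbb{T}$. - $w$ has the reverse Hölder property if there are $1<q<\infty$ and $C>0$ with $\left(\frac1{|Q_I|}\int_{Q_I}w^q\right)^{1/q}\le\frac{C}{|Q_I|}\int_{Q_I}w$ for all $I\subset\mathbb{T}$. - $w\in B_\infty$ if there is $C>0$ with $\int_{Q_I}M(w1_{Q_I})\le C\int_{Q_I}w$ for all $I\subset\mathbb{T}$. A weight $w$ is almost constant on top halves if there is $C\ge1$ with $\operatorname{ess\,sup}_{T_I}w\le C\operatorname{ess\,inf}_{T_I}w$ for all $I\subset\mathbb{T}$. A weight $w$ is called increasing (resp. decreasing) if it is radial, i.e. $w(z)=f(|z|)$ for all $z\in\mathbb{D}$ for some measurable $f:[0,1)\to[0,\infty]$, and $f$ is increasing (resp. decreasing) in the weak (non-strict) sense. *)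

(* Defs.v *)
From HB Require Import structures.
From mathcomp Require Import all_boot all_order all_algebra.
From mathcomp Require Import all_classical all_reals all_analysis.
From mathcomp Require Import measurable_realfun ess_sup_inf.

Set Implicit Arguments.
Unset Strict Implicit.
Unset Printing Implicit Defensive.

Import Order.TTheory GRing.Theory Num.Def Num.Theory.
Import numFieldNormedType.Exports.

Local Open Scope classical_set_scope.
Local Open Scope ring_scope.
Local Open Scope ereal_scope.

(* The complex plane, with its Borel sets as measurable sets: [measurableTypeR R]
   is convertible to R and is the type on which [lebesgue_measure] is stated. *)
Notation plane R := (measurableTypeR R * measurableTypeR R)%type.

(* Functions on the unit disc are
   represented by functions on the whole plane; everything
   below depends only on their values on [disc R]. *)
Section carleson.
Variable R : realType.
Implicit Types (z : plane R) (I A : set (plane R)) (f : plane R -> \bar R) (t : R).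

Definition cabs z : R := Num.sqrt ((z.1 : R) ^+ 2 + (z.2 : R) ^+ 2).

Definition disc : set (plane R) := [set z | (cabs z < 1)%R].

Definition area : {measure set (plane R) -> \bar R} :=
  mscale (NngNum (etrans (invr_ge0 pi) (pi_ge0 R)))
         (@lebesgue_measure R \x @lebesgue_measure R).

Definition avg A f : \bar R := (\int[area]_(z in A) f z) / area A.

Definition cis t : plane R := (cos t, sin t).

Definition arclength I : R :=
  (fine (lebesgue_measure (`[0%R, (2 * pi)%R[%classic `&` cis @^-1` I))
    / (2 * pi))%R.

(* The image of an interval of length at least 2 * pi is the whole circle. *)
Definition circle_arc I : Prop :=
  (exists J : set R, is_interval J /\ I = cis @` J) /\ (0 < arclength I)%R.

Definition direction z : plane R := (z.1 / cabs z, z.2 / cabs z)%R.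

Definition carleson_square I : set (plane R) :=
  [set z | [/\ disc z, z <> (0%R, 0%R), I (direction z)
             & (1 - cabs z < arclength I)%R]].

Definition top_half I : set (plane R) :=
  [set z | [/\ disc z, z <> (0%R, 0%R), I (direction z)
             & (arclength I / 2 < 1 - cabs z < arclength I)%R]].

(* The supremum is over a nonempty family at every z <> 0 of the disc, and the
   origin belongs to no Carleson square. *)
Definition maximal f z : \bar R :=
  ereal_sup [set avg (carleson_square I) (fun u => `|f u|)
            | I in [set I | circle_arc I /\ carleson_square I z]].

(* Essential supremum and infimum over A: off A, the function is replaced by the
   least, resp. greatest, element of \bar R. *)
Definition ess_sup_on A f : \bar R := ess_sup area (patch (cst -oo) A f).
Definition ess_inf_on A f : \bar R := ess_inf area (patch (cst +oo) A f).

End carleson.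

Arguments disc : clear implicits.
Arguments area : clear implicits.

Section weights.
Variable R : realType.
Implicit Type w : plane R -> \bar R.

Definition weight w : Prop :=
  [/\ measurable_fun (disc R) w,
      (forall z, disc R z -> 0 <= w z)
    & {ae area R, forall z, disc R z -> 0 < w z < +oo}].

Definition integrable_weight w : Prop :=
  weight w /\ (area R).-integrable (disc R) w.

Definition conj_exponent (p : R) : R := (p / (p - 1))%R.

(* The library's negative powers of 0 and +oo are not the usual ones, but a
   weight takes these values only on a null set. *)
Definition B_class (p : R) w : Prop :=
  integrable_weight w /\
  exists2 C : R, (0 < C)%R & forall I, circle_arc I ->
    avg (carleson_square I) w *
    avg (carleson_square I) (fun z => w z `^ (1 - conj_exponent p)) `^ (p - 1)
      <= C%:E.

(* The negative part of the integral of log w may be infinite; then the right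
   hand side is 0. *)
Definition reverse_jensen w : Prop :=
  integrable_weight w /\
  exists2 C : R, (0 < C)%R & forall I, circle_arc I ->
    avg (carleson_square I) w
      <= C%:E * expeR (avg (carleson_square I) (fun z => lne (w z))).

Definition reverse_holder w : Prop :=
  integrable_weight w /\
  exists q C : R, [/\ (1 < q)%R, (0 < C)%R & forall I, circle_arc I ->
    avg (carleson_square I) (fun z => w z `^ q) `^ q^-1
      <= C%:E * avg (carleson_square I) w].

Definition B_infty w : Prop :=
  integrable_weight w /\
  exists2 C : R, (0 < C)%R & forall I, circle_arc I ->
    \int[area R]_(z in carleson_square I) maximal (w \_ (carleson_square I)) z
      <= C%:E * \int[area R]_(z in carleson_square I) w z.

Definition almost_constant_top_halves w : Prop :=
  exists2 C : R, (1 <= C)%R & forall I, circle_arc I ->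
    ess_sup_on (top_half I) w <= C%:E * ess_inf_on (top_half I) w.

Definition radial_profile w (f : R -> \bar R) : Prop :=
  [/\ measurable_fun (`[0%R, 1%R[%classic : set R) f,
      (forall r, r \in `[0%R, 1%R[ -> 0 <= f r)
    & forall z, disc R z -> w z = f (cabs z)].

Definition increasing_weight w : Prop :=
  exists2 f : R -> \bar R, radial_profile w f &
    {in `[0%R, 1%R[ &, {homo f : r s / (r <= s)%R >-> r <= s}}.

Definition decreasing_weight w : Prop :=
  exists2 f : R -> \bar R, radial_profile w f &
    {in `[0%R, 1%R[ &, {homo f : r s / (r <= s)%R >-> s <= r}}.

End weights.

(* Main.v *)
Require Import Defs.
From mathcomp Require Import all_boot all_order all_algebra.
From mathcomp Require Import all_classical all_reals all_analysis.
From mathcomp Require Import measurable_realfun ess_sup_inf ring lra.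

(** The idea is that a radial weight has a one-dimensional shadow in which all
    the conditions can be compared by hand.

    Measure the position of z by its depth u = 1 - |z|^2. A sector, the set of
    points whose direction lies in an arc, is invariant under dilations, and
    dilations scale area quadratically; so area on a sector, pushed forward by
    the depth, is a constant multiple of Lebesgue measure on ]0, 1[
    ([area_sector_depth]). The Carleson square of an arc of length h is the part
    of the sector of depth below a = 1 - (1 - h)^2. Hence, for a weight
    w z = g (depth z), all averages over Carleson squares are means of functions
    of g over ]0, a[, where a runs through ]0, 1] ([avg_carleson],
    [forall_arcs]), and the constant cancels. An increasing weight has a
    nonincreasing profile g, a decreasing one a nondecreasing profile, and g is
    positive and finite because a weight is so almost everywhere and at 0
    ([profile_witness]).

    For a nonincreasing profile, all conditions amount to [mean_dominated]: the
    mean of g over ]0, a[ is at most K g a. Each condition shows that a large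
    part of the mass of ]0, a[ sits away from 0, or directly that the mean is
    controlled by a value of g: for reverse Hoelder this is uniform
    integrability ([reverse_holder_small]), for reverse Jensen a tangent
    estimate of the logarithm ([reverse_jensen_set]), and B_p implies reverse
    Jensen by Jensen's inequality. For B_infty, the maximal function at depth u
    is at least the mean of g over an interval ]0, b[ with u < b <= 2 u, and
    integrating B / (2 u) produces a logarithm that must be compensated by the
    smallness of the mass B near 0 ([B_infty_dominated]). Conversely
    domination gives B_2 at once, bounds the maximal function by K w
    ([dominated_B_infty]), and forces the masses of ]0, a / 2^n[ to decay
    geometrically, whence a reverse Hoelder inequality
    ([dominated_reverse_holder]).

    For a nondecreasing profile the pivot is [doubling]: g a <= K g (a / 2).
    It is the one-dimensional form of being almost constant on top halves. It
    makes the mean of g comparable with g a, which gives reverse Hoelder, and it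
    limits the growth of g^(-s) towards 0 to a geometric rate below 2 for small
    s, which gives B_p. The same two estimates as above bring reverse Hoelder
    and reverse Jensen back to doubling.

    The value at the origin is used to extend both pivots from small a to all
    a <= 1 ([mean_dominated_shift], [doubling_near0]). *)

Set Implicit Arguments.
Unset Strict Implicit.
Unset Printing Implicit Defensive.

Import Order.TTheory GRing.Theory Num.Def Num.Theory.
Import numFieldNormedType.Exports.

Local Open Scope classical_set_scope.
Local Open Scope ring_scope.
Local Open Scope ereal_scope.

(** * Monotonicity of the integral *)

Section integral_monotonicity.
Context d (T : measurableType d) (R : realType).
Variable mu : {measure set T -> \bar R}.

Import HBNNSimple.

(** The integral of a nonnegative function is a supremum over the simple functions
    below it, hence monotone for arbitrary functions. Serves to integrate bounds on
    the maximal function, whose measurability is not established. *)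
Lemma nonneg_le_integral (D : set T) (f1 f2 : T -> \bar R) :
  (forall x, D x -> 0 <= f1 x) -> (forall x, D x -> f1 x <= f2 x) ->
  \int[mu]_(x in D) f1 x <= \int[mu]_(x in D) f2 x.
Proof.
move=> f10 f12.
have f20 x : D x -> 0 <= f2 x by move=> Dx; exact: le_trans (f10 _ Dx) (f12 _ Dx).
rewrite !ge0_integralE//; apply: ereal_sup_le => _ [h hf1 <-].
exists h => // x; apply: (le_trans (hf1 x)); rewrite !patchE.
by case: ifPn => // /set_mem; exact: f12.
Qed.

(** Holds even when an integral is of the form oo - oo, because such a difference
    is -oo: this is how averages of log w are bounded from above. *)
Lemma pointwise_le_integral (D : set T) (f1 f2 : T -> \bar R) :
  (forall x, D x -> f1 x <= f2 x) ->
  \int[mu]_(x in D) f1 x <= \int[mu]_(x in D) f2 x.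
Proof.
move=> f12; rewrite (integralE mu D f1) (integralE mu D f2).
apply: leeB; apply: nonneg_le_integral => x Dx; rewrite ?funeposE ?funenegE.
- by rewrite le_max lexx orbT.
- by apply: le_max2 => //; exact: f12.
- by rewrite le_max lexx orbT.
- by apply: le_max2 => //; rewrite leeN2 f12.
Qed.

End integral_monotonicity.

(** * Means over initial intervals *)

Section means.
Variable R : realType.
Local Notation mu := (@lebesgue_measure R).
Implicit Types (a b c u rho : R) (phi : R -> \bar R) (E : set R).

Definition mean a phi : \bar R :=
  (\int[mu]_(u in `]0%R, a[) phi u) * (a^-1)%:E.

Lemma lebesgue_itvoo a b : (a <= b)%R -> mu `]a, b[ = (b - a)%:E.
Proof.
move=> ab; rewrite lebesgue_measure_itv /= lte_fin.
by case: ltgtP ab => // ->; rewrite subrr.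
Qed.

Lemma lebesgue_itvco a b : (a <= b)%R -> mu `[a, b[ = (b - a)%:E.
Proof.
move=> ab; rewrite lebesgue_measure_itv /= lte_fin.
by case: ltgtP ab => // ->; rewrite subrr.
Qed.

Lemma mean_cst a c : (0 < a)%R -> mean a (cst c%:E) = c%:E.
Proof.
move=> a0; rewrite /mean integral_cst//= lebesgue_itvoo ?ltW// subr0.
by rewrite -!EFinM mulfK// gt_eqF.
Qed.

Lemma le_mean a phi psi : (0 < a)%R ->
  (forall u, (0 < u < a)%R -> phi u <= psi u) -> mean a phi <= mean a psi.
Proof.
move=> a0 h; apply: lee_wpmul2r; first by rewrite lee_fin invr_ge0 ltW.
by apply: pointwise_le_integral => u; rewrite /= in_itv /=; exact: h.
Qed.

Lemma mean_le_cst a phi c : (0 < a)%R ->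
  (forall u, (0 < u < a)%R -> phi u <= c%:E) -> mean a phi <= c%:E.
Proof. by move=> a0 h; rewrite -(mean_cst c a0); exact: le_mean. Qed.

Lemma mean_ge_cst a phi c : (0 < a)%R ->
  (forall u, (0 < u < a)%R -> c%:E <= phi u) -> c%:E <= mean a phi.
Proof. by move=> a0 h; rewrite -(mean_cst c a0); exact: le_mean. Qed.

Lemma mean_ge0 a phi : (0 < a)%R ->
  (forall u, (0 < u < a)%R -> 0 <= phi u) -> 0 <= mean a phi.
Proof. by move=> a0 h; exact: (mean_ge_cst a0). Qed.

Lemma integralEmean a phi : (0 < a)%R ->
  \int[mu]_(u in `]0%R, a[) phi u = mean a phi * a%:E.
Proof.
by move=> a0; rewrite /mean -muleA -EFinM mulVf ?gt_eqF// mule1.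
Qed.

Lemma mean_gt0 a phi : (0 < a)%R -> measurable_fun `]0%R, a[ phi ->
  (forall u, (0 < u < a)%R -> 0 < phi u) -> 0 < mean a phi.
Proof.
move=> a0 mphi h; rewrite lt_neqAle mean_ge0 ?andbT//; last first.
  by move=> u /h /ltW.
apply/eqP => /esym m0.
have I0 : \int[mu]_(u in `]0%R, a[) `|phi u| = 0.
  rewrite -[RHS](mul0e a%:E) -m0 -integralEmean//; apply: eq_integral => u.
  by rewrite inE /= in_itv /= => /h /ltW /gee0_abs.
have := (ae_eq_integral_abs mu (measurable_itv _) mphi).1 I0.
move=> [N [mN N0 sub]].
have : mu `]0%R, a[ <= mu N.
  apply: le_measure; rewrite ?inE//= => u ua; apply: sub => /= eq0.
  have := ua; rewrite /= in_itv /= => /h; rewrite eq0 ?ltxx//.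
by rewrite N0 lebesgue_itvoo ?(ltW a0)// subr0 lee_fin leNgt a0.
Qed.

Lemma dyadic_cover a u : (0 < u < a)%R ->
  exists n, (a / 2 ^+ n.+1 <= u < a / 2 ^+ n)%R.
Proof.
move=> /andP[u0 ua]; have a0 := lt_trans u0 ua.
have ex : exists n, (a / 2 ^+ n <= u)%R.
  have [n hn] : exists n : nat, (a / u < n%:R)%R.
    by exists (Num.bound (a / u)); apply: archi_boundP; rewrite divr_ge0 ?ltW.
  exists n; rewrite ler_pdivrMr ?exprn_gt0// -ler_pdivrMl// mulrC.
  rewrite (le_trans (ltW hn))// -natrX ler_nat.
  by rewrite ltnW// ltn_expl.
case: (ex_minnP ex) => [[|n]] hn min.
  by move: hn; rewrite expr0 divr1 leNgt ua.
exists n; rewrite hn /= ltNge; apply/negP => /min.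
by rewrite ltnn.
Qed.

Lemma dyadic_trivIset a : (0 < a)%R ->
  trivIset [set: nat] (fun n => `[(a / 2 ^+ n.+1)%R, (a / 2 ^+ n)%R[%classic).
Proof.
move=> a0; apply/trivIsetP => i j _ _.
wlog: i j / (i < j)%N => [wl ij|ij _].
  by case: (ltngtP i j) ij => // ij _; [|rewrite setIC]; apply: wl => //;
    rewrite ?(ltn_eqF ij)// neq_ltn ij.
rewrite -subset0 => u [] /=; rewrite !in_itv /= => /andP[iu _] /andP[_ uj].
move: (le_lt_trans iu uj); apply/negP; rewrite -leNgt ler_pM2l//.
by rewrite lef_pV2 ?posrE ?exprn_gt0// ler_eXn2l// ltr1n.
Qed.

(** The n-th dyadic piece occupies the fraction 2^-(n+1) of ]0, a[, so the mean is
    at most a geometric series of ratio rho / 2. *)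
Lemma dyadic_mean_le a phi c rho : (0 < a)%R -> (0 <= c)%R -> (0 <= rho < 2)%R ->
  measurable_fun `]0%R, a[ phi -> (forall u, (0 < u < a)%R -> 0 <= phi u) ->
  (forall n u, (a / 2 ^+ n.+1 <= u < a / 2 ^+ n)%R ->
    phi u <= (c * rho ^+ n)%:E) ->
  mean a phi <= (c / (2 - rho))%:E.
Proof.
move=> a0 c0 /andP[rho0 rho2] mphi phi0 phi_le.
pose F n : set R := `[(a / 2 ^+ n.+1)%R, (a / 2 ^+ n)%R[%classic.
have FE : `]0%R, a[%classic = \bigcup_n F n.
  apply/seteqP; split=> u /=.
    by rewrite in_itv /= => /dyadic_cover[n un]; exists n => //=; rewrite /F /= in_itv.
  move=> [n _]; rewrite /F /= !in_itv /= => /andP[nu un]; apply/andP; split.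
    by apply: lt_le_trans nu; rewrite divr_gt0// exprn_gt0.
  by rewrite (lt_le_trans un)// ler_pdivrMr ?exprn_gt0// ler_peMr ?(ltW a0)// exprn_ege1// ler1n.
rewrite /mean FE ge0_integral_bigcup//=; last 4 first.
- by move=> k; exact: measurable_itv.
- by rewrite -FE.
- by move=> u; rewrite -FE /= in_itv /=; exact: phi0.
- exact: dyadic_trivIset.
have a1 : (0 <= a^-1)%R by rewrite invr_ge0 ltW.
have -> : (c / (2 - rho))%:E = (a * (c / (2 - rho)))%:E * (a^-1)%:E.
  by rewrite -EFinM mulrAC mulfV ?mul1r// gt_eqF.
apply: lee_wpmul2r; first by rewrite lee_fin.
have Fint n : \int[mu]_(u in F n) phi u <= (a * c / 2 * (rho / 2) ^+ n)%:E.
  apply: (@le_trans _ _ (\int[mu]_(u in F n) (c * rho ^+ n)%:E)).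
    by apply: pointwise_le_integral => u; rewrite /F /= in_itv /=; exact: phi_le.
  rewrite /F integral_cst//= lebesgue_itvco; last first.
    by rewrite ler_pM2l// lef_pV2 ?posrE ?exprn_gt0// ler_eXn2l// ltr1n.
  rewrite -EFinM lee_fin expr_div_n exprS le_eqVlt; apply/orP; left; apply/eqP.
  by field; rewrite expf_neq0// pnatr_eq0.
apply: lime_le.
  apply: is_cvg_nneseries => n _ _; apply: integral_ge0 => u Fu.
  by apply: phi0; have : (\bigcup_n F n) u by [exists n]; rewrite -FE /= in_itv.
apply: nearW => n; rewrite /=.
apply: (@le_trans _ _ (\sum_(0 <= i < n) (a * c / 2 * (rho / 2) ^+ i)%:E)).
  by apply: lee_sum => i _; exact: Fint.
rewrite sumEFin lee_fin.
have -> : (\sum_(0 <= i < n) a * c / 2 * (rho / 2) ^+ i =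
    a * (c / (2 - rho)) * (1 - (rho / 2) ^+ n))%R.
  elim: n => [|n IH]; first by rewrite big_geq// expr0 subrr mulr0.
  rewrite big_nat_recr//= IH exprS; field.
  by rewrite subr_eq0 gt_eqF.
rewrite ler_piMr//; first by rewrite mulr_ge0 ?(ltW a0)// divr_ge0// subr_ge0 (ltW rho2).
by rewrite lerBlDr lerDl exprn_ge0// divr_ge0.
Qed.

End means.

(** * Profiles of radial weights *)

Section profiles.
Variable R : realType.
Local Notation mu := (@lebesgue_measure R).
Implicit Types (a b c u q s C M K : R) (E : set R).

(** This and the next two definitions are the reverse Hoelder, reverse Jensen and
    B_p conditions read off on the profile g of a radial weight. *)
Definition mean_reverse_holder (g : R -> R) q C := forall a, (0 < a <= 1)%R ->
  mean a (fun u => (g u `^ q)%:E) `^ q^-1 <= C%:E * mean a (EFin \o g).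

Definition mean_reverse_jensen (g : R -> R) C := forall a, (0 < a <= 1)%R ->
  mean a (EFin \o g) <= C%:E * expeR (mean a (fun u => (ln (g u))%:E)).

(** The B_p condition with s = 1 / (p - 1): then 1 - p' = - s and p - 1 = 1 / s. *)
Definition mean_muckenhoupt (g : R -> R) s C := forall a, (0 < a <= 1)%R ->
  mean a (EFin \o g) * mean a (fun u => (g u `^ (- s))%:E) `^ s^-1 <= C%:E.

Variable g : R -> R.
Hypothesis mg : measurable_fun (`]0%R, 1%R[%classic : set R) g.
Hypothesis g_gt0 : forall u, (0 < u <= 1)%R -> (0 < g u)%R.
Hypothesis gint : \int[mu]_(u in `]0%R, 1%R[) (g u)%:E < +oo.

Definition mass a : R := fine (\int[mu]_(u in `]0%R, a[) (g u)%:E).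

Let sub01 a : (a <= 1)%R -> (`]0%R, a[ : set R) `<=` `]0%R, 1%R[.
Proof.
by move=> a1 u; rewrite /= !in_itv /= => /andP[-> /lt_le_trans->].
Qed.

Let mga a : (a <= 1)%R -> measurable_fun (`]0%R, a[%classic : set R) g.
Proof. by move=> a1; apply: measurable_funS mg => //; exact: sub01. Qed.

Let pos01 a u : (a <= 1)%R -> (0 < u < a)%R -> (0 < g u)%R.
Proof.
move=> a1 /andP[u0 ua]; apply: g_gt0.
by rewrite u0 (le_trans (ltW ua)).
Qed.

Lemma massE a : (a <= 1)%R ->
  \int[mu]_(u in `]0%R, a[) (g u)%:E = (mass a)%:E.
Proof.
move=> a1; rewrite /mass fineK// ge0_fin_numE; last first.
  by apply: integral_ge0 => u; rewrite /= in_itv /= lee_fin => /(pos01 a1)/ltW.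
apply: le_lt_trans gint; apply: ge0_subset_integral => //=.
- exact/measurable_EFinP.
- by move=> u; rewrite in_itv /= lee_fin => /(pos01 (lexx 1))/ltW.
- exact: sub01.
Qed.

Lemma mean_massE a : (a <= 1)%R -> mean a (EFin \o g) = (mass a / a)%:E.
Proof. by move=> a1; rewrite /mean massE. Qed.

Lemma mass_gt0 a : (0 < a <= 1)%R -> (0 < mass a)%R.
Proof.
move=> /andP[a0 a1].
have : 0 < mean a (EFin \o g).
  apply: mean_gt0 => //; first by apply/measurable_EFinP; exact: mga.
  by move=> u /(pos01 a1); rewrite lte_fin.
by rewrite mean_massE// lte_fin pmulr_lgt0// invr_gt0.
Qed.

Lemma mass_split a b : (0 < b <= a)%R -> (a <= 1)%R ->
  \int[mu]_(u in `[b, a[) (g u)%:E = (mass a - mass b)%:E.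
Proof.
move=> /andP[b0 ba] a1; rewrite EFinB -!massE ?(le_trans ba)//.
have -> : (`]0%R, a[%classic : set R) = `]0%R, b[ `|` `[b, a[.
  by rewrite -itv_bndbnd_setU// bnd_simp.
rewrite ge0_integral_setU//=.
- by rewrite massE ?(le_trans ba)// addrAC subee// add0r.
- rewrite -itv_bndbnd_setU ?bnd_simp//.
  by apply/measurable_EFinP; exact: mga.
- move=> u; rewrite !in_itv /= lee_fin => ub; apply/ltW/(@pos01 a) => //.
  case: ub => /andP[b1 b2]; first by rewrite b1 (lt_le_trans b2).
  by rewrite b2 andbT (lt_le_trans b0).
- apply/disj_setPS => u [] /=; rewrite !in_itv /= => /andP[_ ub] /andP[bu _].
  by move: (lt_le_trans ub bu); rewrite ltxx.
Qed.

Lemma mass_le a b : (0 < b <= a)%R -> (a <= 1)%R -> (mass b <= mass a)%R.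
Proof.
move=> ba a1; rewrite -subr_ge0 -lee_fin -mass_split//.
apply: integral_ge0 => u; rewrite /= in_itv /= lee_fin => /andP[bu ua].
case/andP: ba => b0 ba; apply/ltW/(@pos01 a) => //.
by rewrite ua (lt_le_trans b0).
Qed.

Lemma mass_diff_le a b M : (0 < b <= a)%R -> (a <= 1)%R ->
  (forall u, (b <= u < a)%R -> (g u <= M)%R) ->
  (mass a - mass b <= (a - b) * M)%R.
Proof.
move=> ba a1 gM; rewrite -lee_fin -mass_split//.
apply: (@le_trans _ _ (\int[mu]_(u in `[b, a[) M%:E)).
  by apply: pointwise_le_integral => u; rewrite /= in_itv lee_fin; exact: gM.
rewrite integral_cst//= lebesgue_itvco; last by case/andP: ba.
by rewrite -EFinM lee_fin mulrC.
Qed.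

Lemma mass_diff_ge a b M : (0 < b <= a)%R -> (a <= 1)%R ->
  (forall u, (b <= u < a)%R -> (M <= g u)%R) ->
  ((a - b) * M <= mass a - mass b)%R.
Proof.
move=> ba a1 gM; rewrite -lee_fin -mass_split//.
apply: (@le_trans _ _ (\int[mu]_(u in `[b, a[) M%:E)); last first.
  by apply: pointwise_le_integral => u; rewrite /= in_itv lee_fin; exact: gM.
rewrite integral_cst//= lebesgue_itvco; last by case/andP: ba.
by rewrite -EFinM lee_fin mulrC.
Qed.

Lemma mass_le_cst a M : (0 < a <= 1)%R ->
  (forall u, (0 < u < a)%R -> (g u <= M)%R) -> (mass a <= a * M)%R.
Proof.
move=> /andP[a0 a1] gM; have := @mean_le_cst R a (EFin \o g) M a0.
by rewrite mean_massE// lee_fin ler_pdivrMr// mulrC; apply => u /gM.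
Qed.

Lemma mass_ge_cst a M : (0 < a <= 1)%R ->
  (forall u, (0 < u < a)%R -> (M <= g u)%R) -> (a * M <= mass a)%R.
Proof.
move=> /andP[a0 a1] gM; have := @mean_ge_cst R a (EFin \o g) M a0.
by rewrite mean_massE// lee_fin ler_pdivlMr// mulrC; apply => u /gM.
Qed.

(** Either x <= N, or N^(1-q) x^q = x (x / N)^(q-1) >= x. It takes the place of
    Hoelder's inequality below. *)
Lemma powR_young (x N q : R) : (0 < x)%R -> (0 < N)%R -> (1 < q)%R ->
  (x <= N + N `^ (1 - q) * x `^ q)%R.
Proof.
move=> x0 N0 q1; have [xN|Nx] := leP x N.
  by rewrite (le_trans xN)// lerDl mulr_ge0 ?powR_ge0.
rewrite -[leLHS]add0r lerD ?(ltW N0)//.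
have -> : (x `^ q = x * x `^ (q - 1))%R.
  by rewrite mulr_powRB1 ?(ltW x0)// (lt_trans ltr01).
rewrite mulrCA ler_peMr ?(ltW x0)//.
have -> : (1 - q = - (q - 1))%R by ring.
rewrite powRN mulrC ler_pdivlMr ?powR_gt0// mul1r.
by rewrite ge0_ler_powR ?nnegrE ?(ltW x0) ?(ltW N0) ?(ltW Nx)// subr_ge0 ltW.
Qed.

Let mgq a q : (a <= 1)%R ->
  measurable_fun (`]0%R, a[%classic : set R) (fun u => (g u `^ q)%:E).
Proof.
move=> a1; apply/measurable_EFinP.
by apply: (@measurableT_comp _ _ _ _ _ _ (@powR R ^~ q)) (mga a1);
  exact: measurable_powR.
Qed.

(** The absolute continuity hidden in a reverse Hoelder inequality: split g on E at
    a large multiple B of its mean A. The part below contributes at most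
    B A mu(E), the part above at most (B A)^(1-q) times the integral of g^q,
    that is a small multiple of A a. *)
Lemma reverse_holder_small q C : (1 < q)%R -> (0 < C)%R ->
  mean_reverse_holder g q C ->
  exists2 e, (0 < e < 1)%R & forall a E, (0 < a <= 1)%R -> measurable E ->
    E `<=` `]0%R, a[ -> mu E <= (e * a)%:E ->
    \int[mu]_(u in E) (g u)%:E <= (mass a / 2)%:E.
Proof.
move=> q1 C0 rh.
have q0 : (0 < q)%R by rewrite (lt_trans ltr01).
have q10 : (0 < q - 1)%R by rewrite subr_gt0.
(* B is chosen so that B^(1-q) C^q = 1/4. *)
pose D := (4 * C `^ q)%R.
have D0 : (0 < D)%R by rewrite mulr_gt0// powR_gt0.
pose B := (D `^ (q - 1)^-1)%R.
have B0 : (0 < B)%R by rewrite powR_gt0.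
have BE : (B `^ (1 - q) = D^-1)%R.
  have -> : (1 - q = - (q - 1))%R by ring.
  by rewrite powRN -powRrM mulVf ?gt_eqF// powRr1// ltW.
(* This makes e B <= 1/4. *)
exists (4 * B + 4)^-1%R.
  rewrite invr_gt0 invf_lt1; first by lra.
  by lra.
move=> a E a01 mE Ea muE; have /andP[a0 a1] := a01.
pose A := (mass a / a)%R.
have A0 : (0 < A)%R by rewrite divr_gt0// mass_gt0.
have Xle : mean a (fun u => (g u `^ q)%:E) <= ((C * A) `^ q)%:E.
  have X0 : 0 <= mean a (fun u => (g u `^ q)%:E).
    by apply: mean_ge0 => // u _; rewrite lee_fin powR_ge0.
  have := rh a a01; rewrite mean_massE// -EFinM -/A => h.
  have := @gt0_ler_poweR R q (ltW q0) _ _ _ _ h.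
  rewrite !in_itv /= !leey !andbT poweR_ge0 => /(_ isT).
  rewrite lee_fin mulr_ge0 ?(ltW C0) ?(ltW A0)// => /(_ isT).
  by rewrite -poweRrM mulVf ?gt_eqF// poweRe1// poweR_EFin.
pose N := (B * A)%R.
have N0 : (0 < N)%R by rewrite mulr_gt0.
have mgE : measurable_fun E (fun u => (g u `^ q)%:E).
  by apply: measurable_funS (mgq q a1) => //; exact: measurable_itv.
apply: (@le_trans _ _ (\int[mu]_(u in E)
    (N%:E + (N `^ (1 - q))%:E * (g u `^ q)%:E))).
  apply: pointwise_le_integral => u /Ea; rewrite /= in_itv /= => /(pos01 a1) gu.
  by rewrite -EFinM -EFinD lee_fin powR_young.
rewrite ge0_integralD//=; last 3 first.
- by move=> u _; rewrite lee_fin ltW.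
- by move=> u _; rewrite mule_ge0// lee_fin powR_ge0.
- exact: measurable_funeM.
rewrite integral_cst// ge0_integralZl//; last 2 first.
- by move=> u _; rewrite lee_fin powR_ge0.
- by rewrite lee_fin powR_ge0.
have h1 : N%:E * mu E <= (mass a / 4)%:E.
  apply: (@le_trans _ _ (N%:E * ((4 * B + 4)^-1 * a)%:E)).
    by apply: lee_wpmul2l => //; rewrite lee_fin ltW.
  rewrite -EFinM lee_fin /N /A.
  have -> : (B * (mass a / a) * ((4 * B + 4)^-1 * a) =
    mass a / 4 * (B / (B + 1)))%R by field; rewrite !gt_eqF//; lra.
  rewrite ler_piMr//; first by rewrite divr_ge0// ltW// mass_gt0.
  by rewrite ler_pdivrMr; lra.
have h2 : (N `^ (1 - q))%:E * \int[mu]_(u in E) (g u `^ q)%:E <= (mass a / 4)%:E.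
  apply: (@le_trans _ _ ((N `^ (1 - q))%:E * (a * (C * A) `^ q)%:E)).
    apply: lee_wpmul2l; first by rewrite lee_fin powR_ge0.
    apply: (@le_trans _ _ (\int[mu]_(u in `]0%R, a[) (g u `^ q)%:E)).
      apply: ge0_subset_integral => //=; first exact: mgq.
      by move=> u _; rewrite lee_fin powR_ge0.
    rewrite integralEmean// mulrC EFinM; apply: lee_wpmul2r => //.
    by rewrite lee_fin ltW.
  rewrite -EFinM lee_fin /N powRM ?(ltW B0) ?(ltW A0)// BE.
  rewrite powRM ?(ltW C0) ?(ltW A0)//.
  have -> : (A `^ q = A * A `^ (q - 1))%R by rewrite mulr_powRB1// ltW.
  have -> : (1 - q = - (q - 1))%R by ring.
  have := powR_gt0 (q - 1) A0; rewrite powRN; set Aq := (A `^ _)%R => Aq0.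
  have := powR_gt0 q C0; rewrite /D; set Cq := (C `^ _)%R => Cq0.
  rewrite le_eqVlt; apply/orP; left; apply/eqP; rewrite /A; field.
  by rewrite !gt_eqF.
apply: (le_trans (leeD h1 h2)); rewrite -EFinD lee_fin; lra.
Qed.

Lemma expR_ln_le (x y : R) : (0 < x)%R -> (ln x <= y)%R -> (x <= expR y)%R.
Proof. by move=> x0; rewrite -ler_expR lnK. Qed.

Lemma ln_le_tangent (x m : R) : (0 < x)%R -> (0 < m)%R ->
  (ln x <= x / m - 1 + ln m)%R.
Proof.
move=> x0 m0; have xm : (0 < x / m)%R by rewrite divr_gt0.
have -> : x = (x / m * m)%R by rewrite divfK ?gt_eqF.
rewrite lnM ?posrE// mulfK ?gt_eqF// lerD2r.
have := @le_ln1Dx R (x / m - 1); rewrite addrCA subrr addr0; apply; lra.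
Qed.

Let integrable_cst_itv a c : (0 < a)%R -> mu.-integrable `]0%R, a[ (cst c%:E).
Proof.
move=> a0; apply/integrableP; split=> //.
rewrite (_ : \int[mu]_(u in _) _ = \int[mu]_(u in `]0%R, a[) `|c|%:E)//.
by rewrite integral_cst//= lebesgue_itvoo ?(ltW a0)// -EFinM ltry.
Qed.

(** If g <= M on a fixed proportion eta of ]0, a[, then bounding log g there by
    log M and elsewhere by the tangent of log at the mean A yields
    log A <= log C + (1 - eta) log A + eta log M + eta, which bounds A by a
    multiple of M. *)
Lemma reverse_jensen_set C (eta : R) : (0 < C)%R -> (0 < eta)%R ->
  mean_reverse_jensen g C ->
  exists2 K, (0 < K)%R & forall a E M, (0 < a <= 1)%R -> measurable E ->
    E `<=` `]0%R, a[ -> mu E = (eta * a)%:E -> (0 < M)%R ->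
    (forall u, E u -> (g u <= M)%R) -> (mass a <= K * (a * M))%R.
Proof.
move=> C0 eta0 rj; exists (expR (1 + ln C / eta)); first exact: expR_gt0.
move=> a E M a01 mE Ea muE M0 gM; have /andP[a0 a1] := a01.
pose A := (mass a / a)%R.
have A0 : (0 < A)%R by rewrite divr_gt0// mass_gt0.
suff : (A <= expR (1 + ln C / eta) * M)%R.
  by rewrite /A ler_pdivrMr// -mulrA (mulrC M).
pose c := (ln A - 1)%R; pose d := (ln M - ln A + 1)%R.
have ln_le : mean a (fun u => (ln (g u))%:E) <= (ln A + eta * d)%:E.
  (* The tangent g / A + log A - 1 off E; adding d on E makes it at least log M. *)
  pose k u : \bar R := (A^-1)%:E * (g u)%:E + (c%:E + d%:E * (\1_E u)%:E).
  apply: (@le_trans _ _ (mean a k)).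
    apply: le_mean => // u ua; have gu := pos01 a1 ua.
    rewrite /k indicE -!EFinM -!EFinD lee_fin.
    have [/set_mem Eu|_] := boolP (u \in E).
      have : (ln (g u) <= ln M)%R by rewrite ler_ln ?posrE//; exact: gM.
      have : (0 <= A^-1 * g u)%R by rewrite mulr_ge0 ?invr_ge0 ?ltW.
      by rewrite /c /d mulr1; lra.
    by have := ln_le_tangent gu A0; rewrite /c mulr0 addr0 mulrC; lra.
  have ig : mu.-integrable `]0%R, a[ (fun u => (g u)%:E).
    apply/integrableP; split; first by apply/measurable_EFinP; exact: mga.
    apply: (@le_lt_trans _ _ (\int[mu]_(u in `]0%R, a[) (g u)%:E)).
      apply: pointwise_le_integral => u; rewrite /= in_itv /= => /(pos01 a1) gu.
      by rewrite /= gtr0_norm.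
    by rewrite massE// ltry.
  have iE : mu.-integrable `]0%R, a[ (fun u => (\1_E u)%:E).
    apply: (le_integrable _ _ _ (integrable_cst_itv 1 a0)) => //.
      by apply/measurable_EFinP; exact: measurable_indic.
    move=> u _; rewrite /= lee_fin indicE normr1.
    by case: (u \in E); rewrite ?normr1 ?normr0.
  have ic : mu.-integrable `]0%R, a[ (cst c%:E) by exact: integrable_cst_itv.
  rewrite /mean /k integralD//=; last 2 first.
  - exact: integrableZl.
  - by apply: integrableD => //; exact: integrableZl.
  rewrite integralZl// massE// integralD//=; last exact: integrableZl.
  rewrite integralZl// integral_cst// integral_indic// setIidl//.
  rewrite /= lebesgue_itvoo ?(ltW a0)// muE -!EFinM lee_fin.
  rewrite le_eqVlt; apply/orP; left; apply/eqP.
  have mA : mass a = (A * a)%R by rewrite /A divfK ?gt_eqF.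
  by rewrite mA /c; field; rewrite !gt_eqF.
have /(le_trans _) h : C%:E * expeR (mean a (fun u => (ln (g u))%:E)) <=
    C%:E * expeR (ln A + eta * d)%:E.
  by apply: lee_wpmul2l; rewrite ?lee_fin ?(ltW C0)// lee_expeR.
have := h _ (rj a a01); rewrite mean_massE// -/A -EFinM lee_fin => Ale.
have lnA : (ln A <= ln C + (ln A + eta * d))%R.
  have : (ln A <= ln (C * expR (ln A + eta * d)))%R.
    by rewrite ler_ln ?posrE// mulr_gt0// expR_gt0.
  by rewrite lnM ?posrE ?expR_gt0// expRK.
have : (ln A <= ln M + (1 + ln C / eta))%R.
  rewrite -(ler_pM2l eta0) mulrDr mulrDr mulr1 mulrC.
  have -> : (eta * (ln C / eta) = ln C)%R by field; rewrite gt_eqF.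
  by rewrite /d in lnA; lra.
move=> /(expR_ln_le A0); rewrite expRD lnK ?posrE// => Ale'.
by rewrite mulrC.
Qed.

(** Jensen's inequality for g^(-s): integrate the tangent bound of log at the
    mean m of g^(-s). Finiteness of m is part of the hypothesis, since the mean of
    g is positive. *)
Lemma muckenhoupt_reverse_jensen s C : (0 < s)%R -> (0 < C)%R ->
  mean_muckenhoupt g s C -> mean_reverse_jensen g C.
Proof.
move=> s0 C0 bp a a01; have /andP[a0 a1] := a01.
pose A := (mass a / a)%R.
have A0 : (0 < A)%R by rewrite divr_gt0// mass_gt0.
have := bp a a01; set Y := mean a (fun u => (g u `^ - s)%:E) => h.
have Y0 : 0 < Y.
  apply: mean_gt0 => //; first exact: mgq.
  by move=> u /(pos01 a1) gu; rewrite lte_fin powR_gt0.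
rewrite mean_massE// -/A in h *.
have Yoo : Y < +oo.
  rewrite ltey; apply/eqP => Yy; move: h.
  by rewrite Yy poweRyr ?invr_eq0 ?gt_eqF// gt0_muley ?lte_fin.
have YE : Y = (fine Y)%:E by rewrite fineK// ge0_fin_numE// ltW.
move: h Y0; rewrite YE; set m := fine Y => h; rewrite lte_fin => m0.
move: h; rewrite poweR_EFin -EFinM lee_fin => h.
have lnm : (- (ln m / s))%:E <= mean a (fun u => (ln (g u))%:E).
  pose k u : \bar R := (- (s * m)^-1)%:E * (g u `^ - s)%:E +
    cst ((1 - ln m) / s)%:E u.
  apply: (@le_trans _ _ (mean a k)); last first.
    apply: le_mean => // u /(pos01 a1) gu.
    rewrite /k /cst -EFinM -EFinD lee_fin.
    have := ln_le_tangent (powR_gt0 (- s) gu) m0; rewrite ln_powR => h1.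
    rewrite -(ler_pM2l s0).
    have -> : (s * (- (s * m)^-1 * g u `^ (- s) + (1 - ln m) / s) =
      - (g u `^ (- s) / m) + 1 - ln m)%R by field; rewrite !gt_eqF.
    by lra.
  have ig : mu.-integrable `]0%R, a[ (fun u => (g u `^ - s)%:E).
    apply/integrableP; split; first exact: mgq.
    apply: (@le_lt_trans _ _ (\int[mu]_(u in `]0%R, a[) (g u `^ - s)%:E)).
      by apply: pointwise_le_integral => u _; rewrite /= ger0_norm// powR_ge0.
    by rewrite integralEmean// -/Y YE -EFinM ltry.
  rewrite /mean /k integralD//=; last 2 first.
  - exact: integrableZl.
  - exact: integrable_cst_itv.
  rewrite integralZl// integralEmean// -/Y YE integral_cst//.
  rewrite /= lebesgue_itvoo ?(ltW a0)// -!EFinM lee_fin.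
  rewrite le_eqVlt; apply/orP; left; apply/eqP.
  by rewrite -/m; field; rewrite !gt_eqF.
apply: (@le_trans _ _ (C%:E * expeR (- (ln m / s))%:E)); last first.
  by apply: lee_wpmul2l; rewrite ?lee_fin ?(ltW C0)// lee_expeR.
rewrite -EFinM lee_fin expRN ler_pdivlMr ?expR_gt0//.
apply: le_trans h; rewrite ler_pM2l//.
by rewrite /powR gt_eqF// mulrC.
Qed.

(** * Nonincreasing profiles *)

Section nonincreasing.
Hypothesis g_noninc : forall u v, (0 < u)%R -> (u <= v)%R -> (v <= 1)%R ->
  (g v <= g u)%R.

(** An A_1-type condition: a nonincreasing profile is bounded from below by g a on
    ]0, a[. *)
Definition mean_dominated K :=
  forall a, (0 < a <= 1)%R -> (mass a <= K * (a * g a))%R.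

(** For a <= e apply the hypothesis at a / e. For a > e the mass is at most mass 1
    and g a >= g 1 > 0: here the value of the weight at the origin enters. *)
Lemma mean_dominated_shift e C : (0 < e < 1)%R -> (0 < C)%R ->
  (forall a, (0 < a <= 1)%R -> (mass a <= C * (a * g (e * a)))%R) ->
  exists2 K, (0 < K)%R & mean_dominated K.
Proof.
move=> /andP[e0 e1] C0 h.
have g1 : (0 < g 1)%R by apply: g_gt0; rewrite ltr01 lexx.
have m1 : (0 < mass 1)%R by apply: mass_gt0; rewrite ltr01 lexx.
exists (C / e + mass 1 / (e * g 1))%R.
  by rewrite addr_gt0 ?divr_gt0 ?mulr_gt0.
move=> a a01; have /andP[a0 a1] := a01; have ga := g_gt0 a01.
rewrite mulrDl; have [ae|ea] := leP a e.
  have ae1 : (0 < a / e <= 1)%R by rewrite divr_gt0//= ler_pdivrMr// mul1r.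
  apply: (@le_trans _ _ (mass (a / e))).
    apply: mass_le; last by case/andP: ae1.
    by rewrite a0 /= ler_pdivlMr// ler_piMr// ltW.
  apply: le_trans (h _ ae1) _; rewrite (mulrC e) divfK ?gt_eqF//.
  rewrite -[leLHS]addr0 lerD//; last first.
    by rewrite ltW// mulr_gt0 ?divr_gt0 ?mulr_gt0.
  by rewrite le_eqVlt; apply/orP; left; apply/eqP; field; rewrite gt_eqF.
apply: (@le_trans _ _ (mass 1)); first by apply: mass_le; rewrite ?a0 ?a1 ?lexx.
rewrite -[leLHS]add0r lerD//; first by rewrite ltW// mulr_gt0 ?divr_gt0 ?mulr_gt0.
rewrite -mulrA ler_peMr ?(ltW m1)// mulrC ler_pdivlMr ?mulr_gt0// mul1r.
rewrite ler_pM ?(ltW e0) ?(ltW g1) ?(ltW ea)//; exact: g_noninc.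
Qed.

(** Half of the mass lies in [e a, a[, where g <= g (e a). *)
Lemma mean_dominated_half e : (0 < e < 1)%R ->
  (forall a, (0 < a <= 1)%R -> (mass (e * a) <= mass a / 2)%R) ->
  exists2 K, (0 < K)%R & mean_dominated K.
Proof.
move=> e01 h; have /andP[e0 e1] := e01.
apply: (mean_dominated_shift e01 (ltr0n R 2)) => a a01; have /andP[a0 a1] := a01.
have ea : (0 < e * a <= a)%R by rewrite mulr_gt0//= ler_piMl// ltW.
have : (mass a - mass (e * a) <= (a - e * a) * g (e * a))%R.
  apply: mass_diff_le => // u /andP[u1 u2]; apply: g_noninc => //.
    by case/andP: ea.
  exact: le_trans (ltW u2) a1.
have ge : (0 < g (e * a))%R.
  by apply: g_gt0; case/andP: ea => -> /le_trans ->.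
have : ((a - e * a) * g (e * a) <= a * g (e * a))%R.
  by rewrite ler_pM2r// lerBlDr lerDl ltW// mulr_gt0.
by have := h a a01; lra.
Qed.

Lemma reverse_holder_dominated q C : (1 < q)%R -> (0 < C)%R ->
  mean_reverse_holder g q C -> exists2 K, (0 < K)%R & mean_dominated K.
Proof.
move=> q1 C0 /(reverse_holder_small q1 C0)[e e01 h].
apply: (mean_dominated_half e01) => a a01.
have /andP[a0 a1] := a01; have /andP[e0 e1] := e01.
have ea : (e * a <= a)%R by rewrite ler_piMl// ltW.
have := h a `]0%R, (e * a)%R[%classic a01 (measurable_itv _).
rewrite massE ?(le_trans ea)// lee_fin; apply.
  by move=> u; rewrite /= !in_itv /= => /andP[-> /lt_le_trans->].
by rewrite lebesgue_itvoo ?subr0// mulr_ge0// ltW.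
Qed.

Lemma reverse_jensen_dominated C : (0 < C)%R ->
  mean_reverse_jensen g C -> exists2 K, (0 < K)%R & mean_dominated K.
Proof.
move=> C0 rj; have h20 : (0 < 2^-1 :> R)%R by rewrite invr_gt0.
have [K K0 hK] := reverse_jensen_set C0 h20 rj.
have h2 : (0 < (2^-1 : R) < 1)%R by lra.
apply: (mean_dominated_shift h2 K0) => a a01; have /andP[a0 a1] := a01.
apply: (hK a `[(2^-1 * a)%R, a[%classic) => //.
- by move=> u; rewrite /= !in_itv /= => /andP[h ->]; rewrite andbT; lra.
- by rewrite lebesgue_itvco; [congr (_%:E); lra|lra].
- by apply: g_gt0; lra.
- move=> u; rewrite /= in_itv /= => /andP[u1 u2]; apply: g_noninc => //; lra.
Qed.

Lemma dominated_muckenhoupt K : (0 < K)%R -> mean_dominated K ->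
  mean_muckenhoupt g 1 K.
Proof.
move=> K0 h a a01; have /andP[a0 a1] := a01; have ga := g_gt0 a01.
rewrite mean_massE// invr1 poweRe1; last first.
  by apply: mean_ge0 => // u _; rewrite lee_fin powR_ge0.
have : mean a (fun u => (g u `^ (- 1))%:E) <= ((g a)^-1)%:E.
  apply: mean_le_cst => // u /andP[u0 ua]; rewrite lee_fin.
  have gu : (0 < g u)%R by apply: (pos01 a1); rewrite u0.
  rewrite powR_inv1 ?(ltW gu)// lef_pV2 ?posrE//.
  by apply: g_noninc => //; exact: ltW.
have A0 : (0 <= mass a / a)%R by rewrite divr_ge0// ltW// mass_gt0.
move=> /(lee_wpmul2l (x := (mass a / a)%:E)); rewrite lee_fin => /(_ A0).
move=> /le_trans; apply; rewrite -EFinM lee_fin.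
rewrite ler_pdivrMr// ler_pdivrMr//; apply: (le_trans (h a a01)).
by rewrite mulrCA mulrC.
Qed.

(** On [a/2, a[ the profile is at least g a, hence carries a fixed fraction
    1 / (2 K) of the mass of ]0, a[; iterate. *)
Lemma dominated_decay K : (2 <= K)%R -> mean_dominated K ->
  forall a n, (0 < a <= 1)%R ->
  (mass (a / 2 ^+ n) <= (1 - (2 * K)^-1) ^+ n * mass a)%R.
Proof.
move=> K2 h a n a01; have /andP[a0 a1] := a01.
elim: n => [|n IH]; first by rewrite !expr0 divr1 mul1r.
set b := (a / 2 ^+ n)%R in IH *.
have b0 : (0 < b)%R by rewrite divr_gt0// exprn_gt0.
have b1 : (b <= 1)%R.
  by rewrite /b ler_pdivrMr ?exprn_gt0// mul1r (le_trans a1)// exprn_ege1// ler1n.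
have -> : (a / 2 ^+ n.+1 = b / 2)%R.
  by rewrite /b exprSr invfM mulrA.
have K0 : (0 < K)%R by lra.
have b01 : (0 < b <= 1)%R by rewrite b0.
have : ((b - b / 2) * g b <= mass b - mass (b / 2))%R.
  apply: mass_diff_ge => //; first by lra.
  move=> u /andP[u1 u2]; apply: g_noninc => //; lra.
have hb := h b b01.
have : ((2 * K)^-1 * mass b <= (b - b / 2) * g b)%R.
  rewrite mulrC ler_pdivrMr; last by lra.
  by rewrite (_ : ((b - b / 2) * g b * (2 * K) = K * (b * g b))%R) //; field.
move=> h1 h2; rewrite exprS -mulrA.
apply: (@le_trans _ _ ((1 - (2 * K)^-1) * mass b)%R); first by lra.
apply: ler_wpM2l => //; rewrite subr_ge0 invf_le1; lra.
Qed.

Lemma exists_powR_eq (x y : R) : (1 < x)%R -> (x < y)%R ->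
  exists2 q, (1 < q)%R & (x `^ q = y)%R.
Proof.
move=> x1 xy; have x0 : (0 < x)%R by lra.
have lx : (0 < ln x)%R by exact: ln_gt0.
exists (ln y / ln x)%R.
  by rewrite ltr_pdivlMr// mul1r ltr_ln// posrE; lra.
rewrite /powR gt_eqF// divfK ?gt_eqF// lnK// posrE; lra.
Qed.

(** A Gehring-type self-improvement: the geometric decay of the masses bounds g on
    the n-th dyadic piece by x^(n+1) times its mean, with x < 2. A power q > 1
    close to 1 keeps x^q < 2, so that the means of g^q converge. *)
Lemma dominated_reverse_holder K : (0 < K)%R -> mean_dominated K ->
  exists q C, [/\ (1 < q)%R, (0 < C)%R & mean_reverse_holder g q C].
Proof.
(* Enlarging K to L >= 2 puts x = 2 - 1 / L above 1. *)
move=> K0 hK0; pose L := (K + 2)%R.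
have L2 : (2 <= L)%R by rewrite /L; lra.
have hL : mean_dominated L.
  move=> a a01; apply: le_trans (hK0 a a01) _; rewrite ler_pM2r /L; first by lra.
  by rewrite mulr_gt0 ?g_gt0//; case/andP: a01.
pose x := (2 * (1 - (2 * L)^-1))%R.
have iL : (0 < (2 * L)^-1 <= 1 / 4)%R.
  rewrite invr_gt0; apply/andP; split; first by lra.
  by rewrite mul1r lef_pV2 ?posrE; lra.
have x1 : (1 < x)%R by rewrite /x; lra.
have x2 : (x < 2)%R by rewrite /x; lra.
pose y := ((x + 2) / 2)%R.
have [|q q1 xq] := exists_powR_eq x1 (y := y); first by rewrite /y; lra.
have y0 : (0 < y)%R by rewrite /y; lra.
have y2 : (y < 2)%R by rewrite /y; lra.
have q0 : (0 < q)%R by lra.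
pose C := ((y / (2 - y)) `^ q^-1)%R.
have yy0 : (0 < y / (2 - y))%R by rewrite divr_gt0// subr_gt0.
exists q, C; split => //; first exact: powR_gt0.
move=> a a01; have /andP[a0 a1] := a01.
pose A := (mass a / a)%R.
have A0 : (0 < A)%R by rewrite divr_gt0// mass_gt0.
have le1 : mean a (fun u => (g u `^ q)%:E) <= (y * A `^ q / (2 - y))%:E.
  apply: dyadic_mean_le => //.
  - by rewrite mulr_ge0 ?powR_ge0// ltW.
  - by rewrite (ltW y0).
  - exact: mgq.
  - by move=> u _; rewrite lee_fin powR_ge0.
  move=> n u /andP[nu un]; rewrite lee_fin.
  have ua : (0 < u < a)%R.
    rewrite (lt_le_trans _ nu) ?divr_gt0 ?exprn_gt0//= (lt_le_trans un)//.
    by rewrite ler_pdivrMr ?exprn_gt0// ler_peMr ?(ltW a0)// exprn_ege1// ler1n.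
  have gu := pos01 a1 ua.
  set b := (a / 2 ^+ n.+1)%R in nu.
  have b0 : (0 < b)%R by rewrite divr_gt0// exprn_gt0.
  have ub : (g u <= x ^+ n.+1 * A)%R.
    apply: (@le_trans _ _ (g b)).
      by apply: g_noninc => //; case/andP: ua => _ /ltW /le_trans ->.
    have b1 : (b <= 1)%R by case/andP: ua => _ ua; rewrite (le_trans nu)// (le_trans (ltW ua)).
    have : (b * g b <= mass b)%R.
      apply: mass_ge_cst; first by rewrite b0.
      by move=> v /andP[v0 vb]; apply: g_noninc => //; exact: ltW.
    move=> /le_trans /(_ (dominated_decay L2 hL n.+1 a01)).
    rewrite mulrC -ler_pdivlMr// => /le_trans; apply.
    rewrite /x exprMn /A /b le_eqVlt; apply/orP; left; apply/eqP.
    by field; rewrite expf_neq0 ?pnatr_eq0// gt_eqF.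
  have -> : (y * A `^ q * y ^+ n = (x ^+ n.+1 * A) `^ q)%R.
    have x0 : (0 <= x)%R by lra.
    rewrite (powRM q (exprn_ge0 n.+1 x0) (ltW A0)) -(powR_mulrn n.+1 x0).
    rewrite powRAC xq powR_mulrn ?(ltW y0)// exprS; ring.
  by rewrite ge0_ler_powR ?nnegrE ?(ltW q0) ?(ltW gu)// (le_trans _ ub)// ltW.
have m0 : 0 <= mean a (fun u => (g u `^ q)%:E).
  by apply: mean_ge0 => // u _; rewrite lee_fin powR_ge0.
have iq0 : (0 <= q^-1)%R by rewrite invr_ge0 ltW.
have := @gt0_ler_poweR R q^-1 iq0 _ _ _ _ le1.
rewrite !in_itv /= !leey !andbT m0 lee_fin => /(_ isT).
have -> : (0 <= y * A `^ q / (2 - y))%R.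
  by rewrite mulrAC mulr_ge0 ?powR_ge0// ltW.
move=> /(_ isT) /le_trans; apply; rewrite mean_massE// -/A -EFinM lee_fin.
have -> : (y * A `^ q / (2 - y) = (y / (2 - y)) * A `^ q)%R by ring.
rewrite powRM ?(ltW yy0) ?powR_ge0// -powRrM mulfV ?gt_eqF// powRr1 ?(ltW A0)//.
Qed.

End nonincreasing.

(** * Nondecreasing profiles *)

Section nondecreasing.
Hypothesis g_nondec : forall u v, (0 < u)%R -> (u <= v)%R -> (v <= 1)%R ->
  (g u <= g v)%R.

Definition doubling K := forall a, (0 < a <= 1)%R -> (g a <= K * g (a / 2))%R.

(** Away from 0 the profile is bounded by g 1 < oo and bounded below by
    g (delta / 2) > 0: here the value of the weight at the origin enters. *)
Lemma doubling_near0 (delta C : R) : (0 < delta <= 1)%R -> (0 < C)%R ->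
  (forall a, (0 < a <= delta)%R -> (g a <= C * g (a / 2))%R) ->
  exists2 K, (1 < K)%R & doubling K.
Proof.
move=> /andP[d0 d1] C0 h.
have g1 : (0 < g 1)%R by apply: g_gt0; lra.
have gd : (0 < g (delta / 2))%R by apply: g_gt0; lra.
have D0 : (0 < g 1 / g (delta / 2))%R by rewrite divr_gt0.
exists (C + g 1 / g (delta / 2) + 1)%R; first by lra.
move=> a a01; have ga : (0 < g (a / 2))%R by apply: g_gt0; lra.
have [ad|ad] := leP a delta.
  apply: (le_trans (h a _)); first by lra.
  rewrite ler_pM2r//; lra.
apply: (@le_trans _ _ (g 1)); first by apply: g_nondec; lra.
apply: (@le_trans _ _ (g 1 / g (delta / 2) * g (a / 2))%R); last by rewrite ler_pM2r//; lra.
rewrite -mulrA ler_peMr ?(ltW g1)// mulrC ler_pdivlMr// mul1r.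
by apply: g_nondec; lra.
Qed.

Lemma doubling_quarter C : (0 < C)%R ->
  (forall a, (0 < a <= 1)%R -> (g (a / 2) <= C * g (a / 4))%R) ->
  exists2 K, (1 < K)%R & doubling K.
Proof.
move=> C0 h; have d01 : (0 < (2^-1 : R) <= 1)%R by lra.
apply: (doubling_near0 d01 C0) => a a2; have := h (2 * a)%R.
rewrite (_ : 2 * a / 2 = a)%R; last by field.
rewrite (_ : 2 * a / 4 = a / 2)%R; last by field.
apply; lra.
Qed.

Lemma half_mass_ge a : (0 < a <= 1)%R -> (a / 2 * g (a / 2) <= mass a)%R.
Proof.
move=> a01; have : ((a - a / 2) * g (a / 2) <= mass a - mass (a / 2))%R.
  apply: mass_diff_ge; try lra.
  by move=> u ua; apply: g_nondec; lra.
have : (0 < mass (a / 2))%R by apply: mass_gt0; lra.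
have -> : (a - a / 2 = a / 2)%R by lra.
lra.
Qed.

Lemma mass_le_max a : (0 < a <= 1)%R -> (mass a <= a * g a)%R.
Proof.
by move=> a01; apply: mass_le_cst => // u ua; apply: g_nondec; lra.
Qed.

(** Removing the last fraction e of ]0, a[ loses at most half of the mass. After n
    removals one is left with a subinterval of ]0, a/4[, of mass at least
    2^-n mass a; compare with the bounds a/2 g(a/2) <= mass a and
    mass (a/4) <= a/4 g(a/4). *)
Lemma reverse_holder_doubling q C : (1 < q)%R -> (0 < C)%R ->
  mean_reverse_holder g q C -> exists2 K, (1 < K)%R & doubling K.
Proof.
move=> q1 C0 /(reverse_holder_small q1 C0)[e e01 h].
have /andP[e0 e1] := e01.
pose f := (1 - e)%R.
have half a : (0 < a <= 1)%R -> (mass a <= 2 * mass (f * a))%R.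
  move=> a01; have /andP[a0 a1] := a01.
  have fa : (0 < f * a <= a)%R.
    rewrite mulr_gt0//=; last by rewrite subr_gt0.
    by rewrite ler_piMl ?(ltW a0)// lerBlDr lerDl ltW.
  have := h a `[(f * a)%R, a[%classic a01 (measurable_itv _).
  rewrite mass_split// lee_fin lebesgue_itvco; last by case/andP: fa.
  have -> : (a - f * a = e * a)%R by rewrite /f; ring.
  rewrite lexx => h1; have : (mass a - mass (f * a) <= mass a / 2)%R.
    apply: h1 => // u; rewrite /= !in_itv /= => /andP[u1 ->]; rewrite andbT.
    by case/andP: fa => f0 _; exact: lt_le_trans u1.
  lra.
have f01 : (0 < f < 1)%R by rewrite /f; lra.
have iter n a : (0 < a <= 1)%R -> (mass a <= 2 ^+ n * mass (f ^+ n * a))%R.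
  move=> a01; have /andP[a0 a1] := a01.
  elim: n => [|n IH]; first by rewrite !expr0 !mul1r.
  apply: (le_trans IH); rewrite exprSr -mulrA ler_pM2l ?exprn_gt0//.
  rewrite exprS -mulrA; apply: half; apply/andP; split.
    by rewrite mulr_gt0// exprn_gt0//; case/andP: f01.
  rewrite -[leRHS]mulr1 ler_pM ?(ltW a0)// ?exprn_ge0 ?exprn_ile1//; lra.
have [n fn] : exists n : nat, (f ^+ n <= 4^-1)%R.
  have : (fun n => (f ^+ n)%R) @ \oo --> (0%R : R^o).
    by apply: cvg_expr; rewrite ger0_norm; lra.
  move=> /cvgrPdist_le /(_ 4^-1%R) []; first by rewrite invr_gt0.
  move=> n _ /(_ n (leqnn _)) /=; rewrite sub0r normrN ger0_norm ?exprn_ge0//; last by lra.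
  by exists n.
apply: (@doubling_quarter (2 ^+ n)); first by rewrite exprn_gt0.
move=> a a01; have /andP[a0 a1] := a01.
have fna : (0 < f ^+ n * a <= a / 4)%R.
  rewrite mulr_gt0 ?exprn_gt0//; last by lra.
  by rewrite /= [leRHS]mulrC ler_pM2r.
have h1 := half_mass_ge a01.
have h2 := iter n a a01.
have h3 : (mass (f ^+ n * a) <= mass (a / 4))%R by apply: mass_le; lra.
have h4 : (mass (a / 4) <= a / 4 * g (a / 4))%R by apply: mass_le_max; lra.
have p0 : (0 < 2 ^+ n :> R)%R by rewrite exprn_gt0.
have g4 : (0 < g (a / 4))%R by apply: g_gt0; lra.
have : (a / 2 * g (a / 2) <= 2 ^+ n * (a / 4 * g (a / 4)))%R.
  rewrite (le_trans h1)// (le_trans h2)// ler_pM2l//; exact: le_trans h3 h4.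
have a20 : (0 < a / 2)%R by lra.
move=> h5; rewrite -(ler_pM2l a20); apply: (le_trans h5).
have : (0 < 2 ^+ n * (a * g (a / 4)))%R by rewrite mulr_gt0// mulr_gt0.
by rewrite (_ : (2 ^+ n * (a / 4 * g (a / 4)) = 2 ^+ n * (a * g (a / 4)) / 4)%R);
  [rewrite (_ : (a / 2 * (2 ^+ n * g (a / 4)) = 2 ^+ n * (a * g (a / 4)) / 2)%R);
  [lra|field]|field].
Qed.

(** With E = ]0, a/4[ the mean is bounded by a multiple of g (a/4), while it is at
    least g (a/2) / 2. Splitting at a/2 would only compare g (a/2) with itself. *)
Lemma reverse_jensen_doubling C : (0 < C)%R ->
  mean_reverse_jensen g C -> exists2 K, (1 < K)%R & doubling K.
Proof.
move=> C0 rj; have h40 : (0 < 4^-1 :> R)%R by rewrite invr_gt0.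
have [K K0 hK] := reverse_jensen_set C0 h40 rj.
apply: (@doubling_quarter (2 * K)); first by rewrite mulr_gt0.
move=> a a01; have /andP[a0 a1] := a01.
have h1 := half_mass_ge a01.
have g4 : (0 < g (a / 4))%R by apply: g_gt0; lra.
have : (mass a <= K * (a * g (a / 4)))%R.
  apply: (hK a `]0%R, (a / 4)%R[%classic) => //.
  - by move=> u; rewrite /= !in_itv /= => /andP[-> h]; lra.
  - by rewrite lebesgue_itvoo; [congr (_%:E); lra|lra].
  - by move=> u; rewrite /= in_itv /= => ?; apply: g_nondec => //; lra.
move=> /(le_trans h1).
move=> h2; rewrite -(ler_pM2l a0).
rewrite (_ : (a * (2 * K * g (a / 4)) = 2 * (K * (a * g (a / 4))))%R); last by ring.
move: h2; rewrite (_ : (a / 2 * g (a / 2) = a * g (a / 2) / 2)%R); last by field.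
lra.
Qed.

Lemma doubling_reverse_holder K : (1 < K)%R -> doubling K ->
  mean_reverse_holder g 2 (2 * K).
Proof.
move=> K1 hK a a01; have /andP[a0 a1] := a01; have ga := g_gt0 a01.
rewrite mean_massE//.
have le1 : mean a (fun u => (g u `^ 2)%:E) <= (g a `^ 2)%:E.
  apply: mean_le_cst => // u /andP[u0 ua]; rewrite lee_fin.
  have gu : (0 < g u)%R by apply: (pos01 a1); rewrite u0.
  rewrite ge0_ler_powR ?nnegrE ?(ltW gu) ?(ltW ga)//.
  by apply: g_nondec => //; exact: ltW.
have m0 : 0 <= mean a (fun u => (g u `^ 2)%:E).
  by apply: mean_ge0 => // u _; rewrite lee_fin powR_ge0.
have iq0 : (0 <= 2^-1 :> R)%R by rewrite invr_ge0.
have := @gt0_ler_poweR R 2^-1 iq0 _ _ _ _ le1.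
rewrite !in_itv /= !leey !andbT m0 lee_fin powR_ge0 => /(_ isT isT) /le_trans; apply.
rewrite -EFinM lee_fin -powRrM mulfV ?pnatr_eq0// powRr1 ?(ltW ga)//.
apply: (le_trans (hK a a01)); rewrite mulrA ler_pdivlMr//.
have := half_mass_ge a01; rewrite -(ler_pM2l (x := (2 * K)%R)); last by lra.
by rewrite (_ : (2 * K * (a / 2 * g (a / 2)) = K * g (a / 2) * a)%R); last by field.
Qed.

(** Doubling gives g >= K^-(n+1) g a on the n-th dyadic piece, so g^(-s) grows by
    the factor K^s from one piece to the next; s makes this factor 3/2 < 2. *)
Lemma doubling_muckenhoupt K : (1 < K)%R -> doubling K ->
  exists s C, [/\ (0 < s)%R, (0 < C)%R & mean_muckenhoupt g s C].
Proof.
move=> K1 hK; have K0 : (0 < K)%R by lra.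
have lK : (0 < ln K)%R by exact: ln_gt0.
pose rho := (3 / 2 : R)%R.
pose s := (ln rho / ln K)%R.
have s0 : (0 < s)%R by rewrite divr_gt0// ln_gt0// /rho; lra.
have Ks : (K `^ s = rho)%R.
  by rewrite /powR gt_eqF// divfK ?gt_eqF// lnK// posrE /rho; lra.
have r0 : (0 < rho)%R by rewrite /rho; lra.
exists s, ((rho / (2 - rho)) `^ s^-1)%R; split => //.
  by rewrite powR_gt0// divr_gt0// /rho; lra.
move=> a a01; have /andP[a0 a1] := a01; have ga := g_gt0 a01.
rewrite mean_massE//.
have le1 : mean a (fun u => (g u `^ (- s))%:E) <=
    (rho * g a `^ (- s) / (2 - rho))%:E.
  apply: dyadic_mean_le => //.
  - by rewrite mulr_ge0 ?powR_ge0// ltW.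
  - by rewrite /rho; lra.
  - exact: mgq.
  - by move=> u _; rewrite lee_fin powR_ge0.
  move=> n u /andP[nu un]; rewrite lee_fin.
  have ua : (0 < u < a)%R.
    rewrite (lt_le_trans _ nu) ?divr_gt0 ?exprn_gt0//= (lt_le_trans un)//.
    by rewrite ler_pdivrMr ?exprn_gt0// ler_peMr ?(ltW a0)// exprn_ege1// ler1n.
  have gu := pos01 a1 ua.
  have iterK m : (g a <= K ^+ m * g (a / 2 ^+ m))%R.
    elim: m => [|m IH]; first by rewrite !expr0 mul1r divr1.
    apply: (le_trans IH); rewrite exprSr -mulrA ler_pM2l ?exprn_gt0//.
    have -> : (a / 2 ^+ m.+1 = a / 2 ^+ m / 2)%R by rewrite exprSr invfM mulrA.
    apply: hK; rewrite divr_gt0 ?exprn_gt0//= ler_pdivrMr ?exprn_gt0// mul1r.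
    by rewrite (le_trans a1)// exprn_ege1// ler1n.
  have gau : (g a <= K ^+ n.+1 * g u)%R.
    apply: (le_trans (iterK n.+1)); rewrite ler_pM2l ?exprn_gt0//.
    apply: g_nondec => //; first by rewrite divr_gt0// exprn_gt0.
    by case/andP: ua => _ /ltW /le_trans ->.
  have -> : (rho * g a `^ (- s) * rho ^+ n = rho ^+ n.+1 * g a `^ (- s))%R.
    by rewrite exprS; ring.
  rewrite !powRN -Ks -powR_mulrn ?powR_ge0// powRAC powR_mulrn ?(ltW K0)//.
  rewrite ler_pdivlMr ?powR_gt0// mulrC ler_pdivrMr ?powR_gt0//.
  rewrite -powRM ?exprn_ge0 ?(ltW K0) ?(ltW gu)//.
  by rewrite ge0_ler_powR ?nnegrE ?(ltW s0) ?(ltW ga)// mulr_ge0 ?(ltW gu)// exprn_ge0// ltW.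
have m0 : 0 <= mean a (fun u => (g u `^ (- s))%:E).
  by apply: mean_ge0 => // u _; rewrite lee_fin powR_ge0.
have iq0 : (0 <= s^-1)%R by rewrite invr_ge0 ltW.
have := @gt0_ler_poweR R s^-1 iq0 _ _ _ _ le1.
have rr : (0 < rho / (2 - rho))%R by rewrite divr_gt0// /rho; lra.
rewrite !in_itv /= !leey !andbT m0 lee_fin => /(_ isT).
have eqr : (rho * g a `^ (- s) / (2 - rho) = (rho / (2 - rho)) * g a `^ (- s))%R by ring.
have -> : (0 <= rho * g a `^ (- s) / (2 - rho))%R.
  by rewrite eqr mulr_ge0 ?powR_ge0// ltW.
move=> /(_ isT) h.
have A0 : (0 < mass a / a)%R by rewrite divr_gt0// mass_gt0.
apply: (le_trans (lee_wpmul2l _ h)); first by rewrite lee_fin ltW.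
rewrite -EFinM lee_fin eqr.
rewrite powRM ?(ltW rr) ?powR_ge0// -powRrM mulNr mulfV ?gt_eqF//.
rewrite powR_inv1 ?(ltW ga)// mulrCA ler_piMr ?powR_ge0//.
rewrite ler_pdivrMr// mul1r ler_pdivrMr// mulrC; exact: mass_le_max.
Qed.

End nondecreasing.

End profiles.

(** * Arcs of the circle *)

Section arcs.
Variable R : realType.
Local Notation mu := (@lebesgue_measure R).
Implicit Types (z : plane R) (J : set R) (s e t m d : R).

Definition sqnorm z : R := ((z.1 : R) ^+ 2 + (z.2 : R) ^+ 2)%R.

(** The inner product of z with the unit vector of angle m. *)
Definition dot_cis m z : R := (cos m * (z.1 : R) + sin m * (z.2 : R))%R.

Lemma sqnorm_ge0 z : (0 <= sqnorm z)%R.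
Proof. by rewrite addr_ge0// sqr_ge0. Qed.

Lemma sqnorm_eq0 z : sqnorm z = 0%R -> z = (0%R, 0%R).
Proof.
case: z => x y /eqP; rewrite /sqnorm /= paddr_eq0 ?sqr_ge0//.
by rewrite !sqrf_eq0 => /andP[/eqP -> /eqP ->].
Qed.

Lemma sqnorm_gt0 z : z <> (0%R, 0%R) -> (0 < sqnorm z)%R.
Proof.
move=> z0; rewrite lt_neqAle sqnorm_ge0 andbT eq_sym.
by apply/eqP => /sqnorm_eq0.
Qed.

Lemma sqnorm_cis t : sqnorm (cis t) = 1%R.
Proof. exact: cos2Dsin2. Qed.

Lemma dot_cis_cis m t : dot_cis m (cis t) = cos (t - m).
Proof. by rewrite cosB /dot_cis /= mulrC; congr (_ + _)%R; rewrite mulrC. Qed.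

Lemma dot_cis_bound m z : sqnorm z = 1%R -> (-1 <= dot_cis m z <= 1)%R.
Proof.
move=> z1; rewrite -ler_norml -(@ler_pXn2r _ 2)// ?nnegrE// expr1n.
rewrite real_normK ?num_real//.
have : (dot_cis m z ^+ 2 + (cos m * z.2 - sin m * z.1) ^+ 2 =
   (cos m ^+ 2 + sin m ^+ 2) * sqnorm z)%R by rewrite /dot_cis /sqnorm; ring.
rewrite cos2Dsin2 z1 mulr1 => <-.
by rewrite lerDl sqr_ge0.
Qed.

Lemma ler_cos_itv : {in `[0%R, pi] &, {mono (@cos R) : x y /~ (y <= x)%R}}.
Proof. by move=> x y xI yI; rewrite leNgt ltr_cos// -leNgt. Qed.

(** The angle is m + acos c or m - acos c, according to the side of the line
    spanned by cis m on which z lies. *)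
Lemma unit_polar m z : sqnorm z = 1%R ->
  exists t, [/\ z = cis t & `|t - m|%R = acos (dot_cis m z)].
Proof.
move=> z1; have cb := dot_cis_bound m z1.
set c := dot_cis m z in cb *.
pose x := (cos m * z.2 - sin m * z.1)%R.
have cx : (c ^+ 2 + x ^+ 2 = 1)%R.
  have : (c ^+ 2 + x ^+ 2 = (cos m ^+ 2 + sin m ^+ 2) * sqnorm z)%R.
    by rewrite /c /x /dot_cis /sqnorm; ring.
  by rewrite cos2Dsin2 z1 mulr1.
have sac : (sin (acos c) = `|x|)%R.
  rewrite sin_acos//; have -> : (1 - c ^+ 2 = x ^+ 2)%R by rewrite -cx addrAC subrr add0r.
  by rewrite sqrtr_sqr.
have cac : (cos (acos c) = c)%R by rewrite acosK// in_itv.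
pose t := (m + (if 0 <= x then acos c else - acos c))%R.
have ct : (cos (t - m) = c)%R.
  by rewrite /t addrAC subrr add0r; case: ifP => _; rewrite ?cosN cac.
have st : (sin (t - m) = x)%R.
  rewrite /t addrAC subrr add0r; case: ifPn => x0; rewrite ?sinN sac.
    by rewrite ger0_norm.
  by rewrite ltr0_norm ?opprK// ltNge.
exists t; split; last first.
  rewrite /t addrAC subrr add0r; case: ifP => _; rewrite ?normrN ger0_norm//;
  exact: acos_ge0.
have cE : (cos t = c * cos m - x * sin m)%R by rewrite -ct -st -cosD subrK.
have sE : (sin t = x * cos m + c * sin m)%R by rewrite -ct -st -sinD subrK.
have cm := cos2Dsin2 m.
rewrite [LHS]surjective_pairing /cis cE sE /c /x /dot_cis; apply/esym.
congr (_, _).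
  rewrite (_ : (_ - _ = (cos m ^+ 2 + sin m ^+ 2) * z.1)%R); last by ring.
  by rewrite cm mul1r.
rewrite (_ : (_ + _ = (cos m ^+ 2 + sin m ^+ 2) * z.2)%R); last by ring.
by rewrite cm mul1r.
Qed.

(** Capped at pi, where the arc becomes the whole circle and cos stops decreasing. *)
Definition half_width s e : R := Num.min ((e - s) / 2)%R pi.

Lemma half_width_itv s e : (s <= e)%R -> half_width s e \in `[0%R, pi].
Proof.
by move=> se; rewrite in_itv /= /half_width le_min ge_min lexx pi_ge0 orbT !andbT; lra.
Qed.

(** A closed arc is cut out of the circle by a half-plane, which makes it
    measurable and makes explicit a neighbourhood of its midpoint. *)
Lemma closed_arcE s e : (s <= e)%R ->
  (@cis R) @` `[s, e] = [set z : plane R | sqnorm z = 1%R /\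
    (cos (half_width s e) <= dot_cis ((s + e) / 2) z)%R].
Proof.
move=> se; have hI := half_width_itv se.
have piI : pi \in `[0%R, pi : R] by rewrite in_itv /= pi_ge0 lexx.
apply/seteqP; split=> [_ [t tI <-]|z [z1 zle]] /=.
  split; first exact: sqnorm_cis.
  rewrite dot_cis_cis; move: tI; rewrite /= in_itv /= => /andP[st te].
  have [tp|pt] := leP `|t - (s + e) / 2|%R pi.
    rewrite -(cos_norm (t - _)) ler_cos_itv//; last by rewrite in_itv /= normr_ge0.
    by rewrite /half_width le_min tp andbT ler_norml; lra.
  have -> : half_width s e = pi.
    rewrite /half_width; apply: min_r; rewrite (le_trans (ltW pt))// ler_norml; lra.
  by rewrite cospi cos_geN1.
have [t [zt tm]] := unit_polar ((s + e) / 2) z1.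
have cb := dot_cis_bound ((s + e) / 2) z1.
exists t => //; have : (`|t - (s + e) / 2| <= half_width s e)%R.
  rewrite tm -ler_cos_itv//; last by rewrite in_itv /= acos_ge0 ?acos_lepi.
  by rewrite acosK// in_itv.
rewrite /half_width le_min => /andP[+ _]; rewrite ler_norml /= in_itv /=; lra.
Qed.

Lemma measurable_sqnorm : measurable_fun [set: plane R] sqnorm.
Proof.
apply: measurable_funD; apply: measurable_funX;
  [exact: measurable_fst|exact: measurable_snd].
Qed.

Lemma measurable_dot_cis m : measurable_fun [set: plane R] (dot_cis m).
Proof.
apply: measurable_funD.
- by apply: measurable_funM => //; exact: measurable_fst.
- by apply: measurable_funM => //; exact: measurable_snd.
Qed.

Lemma measurable_closed_arc s e : measurable ((@cis R) @` `[s, e] : set (plane R)).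
Proof.
have [se|es] := leP s e; last first.
  by rewrite set_itv_ge ?image_set0// -leNgt bnd_simp.
rewrite closed_arcE//.
rewrite (_ : [set _ | _] = (sqnorm @^-1` [set 1%R]) `&`
  (dot_cis ((s + e) / 2) @^-1` `[cos (half_width s e), +oo[)); last first.
  by apply/seteqP; split=> z /=; rewrite in_itv /= andbT.
apply: measurableI; rewrite -[X in measurable X]setTI.
- by apply: measurable_sqnorm => //; exact: measurable_set1.
- by apply: measurable_dot_cis => //; exact: measurable_itv.
Qed.

(** Approximate an open end point from inside by 1 / (n + 1) and an infinite one by
    n. Together with closed_arcE this makes every arc measurable. *)
Lemma interval_bigcup_closed J : is_interval J ->
  exists s e : nat -> R, J = \bigcup_n `[s n, e n]%classic.
Proof.
have [[w0 Jy]|J0] := pselect (exists w0, J w0); last first.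
  move=> _; exists (fun=> 1%R), (fun=> 0%R); apply/seteqP; split=> x.
    by move=> Jx; case: J0; exists x.
  by move=> [n _] /=; rewrite in_itv /=; lra.
move=> /is_intervalP JE; move: Jy; rewrite JE; case: (Rhull J) => a b.
rewrite /= itv_boundlr /= => /andP[ya yb].
have [s [s1 s2]] : exists s : nat -> R,
    (forall n x, (s n <= x)%R -> (a <= BLeft x)%O) /\
    (forall x, (a <= BLeft x)%O -> exists N, forall n, (N <= n)%N -> (s n <= x)%R).
  case: a ya => [[] x|[]] ya //.
  - by exists (fun=> x); split=> [n y|y]; rewrite bnd_simp// => xy; exists 0%N.
  - exists (fun n => x + n.+1%:R^-1)%R; split=> [n y|y]; rewrite bnd_simp.
      by apply: lt_le_trans; rewrite ltrDl invr_gt0.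
    move=> xy; have := ltr_add_invr xy.
    move=> [N hN]; exists N => n Nn; rewrite (le_trans _ (ltW hN))// lerD2l.
    by rewrite lef_pV2 ?posrE// ler_nat.
  - exists (fun n => - n%:R)%R; split=> // x _.
    exists (Num.bound `|x|) => n hn; rewrite lerNl.
    have /ltW h := archi_boundP (normr_ge0 x).
    by rewrite (le_trans _ (le_trans h _)) ?ler_nat// -normrN ler_norm.
have [e [e1 e2]] : exists e : nat -> R,
    (forall n x, (x <= e n)%R -> (BRight x <= b)%O) /\
    (forall x, (BRight x <= b)%O -> exists N, forall n, (N <= n)%N -> (x <= e n)%R).
  case: b yb => [[] x|[]] yb //.
  - exists (fun n => x - n.+1%:R^-1)%R; split=> [n y|y]; rewrite bnd_simp.
      by move=> /le_lt_trans; apply; rewrite ltrBlDr ltrDl invr_gt0.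
    move=> xy; have [N hN] := ltr_add_invr xy.
    exists N => n Nn; rewrite lerBrDr (le_trans _ (ltW hN))// lerD2l.
    by rewrite lef_pV2 ?posrE// ler_nat.
  - by exists (fun=> x); split=> [n y|y]; rewrite bnd_simp// => xy; exists 0%N.
  - exists (fun n => n%:R)%R; split=> // x _.
    exists (Num.bound `|x|) => n hn.
    have /ltW h := archi_boundP (normr_ge0 x).
    by rewrite (le_trans (ler_norm x))// (le_trans h)// ler_nat.
exists s, e; apply/seteqP; split=> x /=; rewrite itv_boundlr /=.
  move=> /andP[/s2[N hN] /e2[M hM]]; exists (maxn N M) => //=.
  by rewrite in_itv /= hN ?leq_maxl// hM// leq_maxr.
move=> [n _] /=; rewrite in_itv /= => /andP[sx xe].
by rewrite (s1 _ _ sx) (e1 _ _ xe).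
Qed.

Lemma measurable_arc J : is_interval J -> measurable ((@cis R) @` J).
Proof.
move=> /interval_bigcup_closed[s [e ->]]; rewrite image_bigcup.
by apply: bigcup_measurable => n _; exact: measurable_closed_arc.
Qed.

Lemma measurable_cis : measurable_fun [set: R] (@cis R : R -> plane R).
Proof.
apply/measurable_fun_pairP; split; apply: continuous_measurable_fun.
- exact: continuous_cos.
- exact: continuous_sin.
Qed.

Lemma cis_eq_angle s t : cis s = cis t -> (`|s - t| <= 2 * pi)%R ->
  [\/ s = t, s = t + 2 * pi | s = t - 2 * pi]%R.
Proof.
move=> st; set d := (s - t)%R => d2.
have cd : cos d = 1%R by rewrite -dot_cis_cis st dot_cis_cis subrr cos0.
have : sin (d / 2) = 0%R.
  have : cos d = (1 - 2 * sin (d / 2) ^+ 2)%R.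
    have {1}-> : d = (d / 2 + d / 2)%R by field.
    by rewrite cosD; have := cos2Dsin2 (d / 2); lra.
  rewrite cd => h; have /eqP : (sin (d / 2) ^+ 2 = 0)%R by lra.
  by rewrite sqrf_eq0 => /eqP.
have [d0|d0] := leP 0%R d.
  rewrite ger0_norm// in d2; case: (ltgtP d 0%R) d0 => // [d0|d0] _ sd; last first.
    by apply: Or31; rewrite /d in d0; lra.
  have [d22|d22] := leP (2 * pi)%R d.
    by apply: Or32; rewrite /d in d22 d2 *; lra.
  have : (0 < sin (d / 2))%R by apply: sin_gt0_pi; lra.
  by rewrite sd ltxx.
rewrite ltr0_norm// in d2 => sd.
have [d22|d22] := leP d (- (2 * pi))%R.
  by apply: Or33; rewrite /d in d22 d2 *; lra.
have : (0 < sin (- (d / 2)))%R by apply: sin_gt0_pi; lra.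
by rewrite sinN sd oppr0 ltxx.
Qed.

Lemma pi2_gt0 : (0 < 2 * pi :> R)%R.
Proof. by rewrite mulr_gt0// pi_gt0. Qed.

Lemma measurable_arc_angles (I : set (plane R)) : measurable I ->
  measurable (`[0%R, (2 * pi)%R[%classic `&` (@cis R) @^-1` I).
Proof.
move=> mI; apply: measurableI => //; rewrite -[X in measurable X]setTI.
exact: measurable_cis.
Qed.

Lemma arclengthE (I : set (plane R)) : measurable I ->
  mu (`[0%R, (2 * pi)%R[%classic `&` (@cis R) @^-1` I) =
  (arclength I * (2 * pi))%:E.
Proof.
move=> mI; rewrite /arclength divfK; last by rewrite gt_eqF// pi2_gt0.
rewrite fineK// ge0_fin_numE//; apply: (@le_lt_trans _ _ (mu `[0%R, (2 * pi)%R[)).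
  by apply: le_measure; rewrite ?inE//; exact: measurable_arc_angles.
by rewrite lebesgue_measure_itv /= lte_fin pi2_gt0 -EFinB ltry.
Qed.

Lemma arclength_le1 (I : set (plane R)) : measurable I -> (arclength I <= 1)%R.
Proof.
move=> mI; have := pi2_gt0 => p0.
rewrite -(ler_pM2r p0) mul1r -lee_fin -arclengthE//.
apply: (@le_trans _ _ (mu `[0%R, (2 * pi)%R[)).
  by apply: le_measure; rewrite ?inE//; exact: measurable_arc_angles.
by rewrite lebesgue_measure_itv /= lte_fin p0 -EFinB subr0.
Qed.

(** The angles in [0, 2 pi[ with direction in the arc lie between [s, e[ and
    [s, e] plus the two points 0 and 2 pi, which represent the same direction. *)
Lemma arclength_closed_arc s e : (0 <= s)%R -> (s < e)%R -> (e <= 2 * pi)%R ->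
  arclength ((@cis R) @` `[s, e]) = ((e - s) / (2 * pi))%R.
Proof.
move=> s0 se e2; have p0 := pi2_gt0.
set I := (_ @` _); have mI : measurable I by exact: measurable_closed_arc.
suff : mu (`[0%R, (2 * pi)%R[%classic `&` (@cis R) @^-1` I) = (e - s)%:E.
  by rewrite arclengthE// => -[<-]; rewrite mulfK// gt_eqF.
have lenE : mu `[s, e] = (e - s)%:E by rewrite lebesgue_measure_itv /= lte_fin se.
have lenE' : mu `[s, e[ = (e - s)%:E by rewrite lebesgue_measure_itv /= lte_fin se.
apply/eqP; rewrite eq_le; apply/andP; split; last first.
  rewrite -lenE'.
  apply: le_measure; rewrite ?inE//; first exact: measurable_arc_angles.
  move=> t; rewrite /= !in_itv /= => /andP[st te]; split; first by lra.
  by exists t => //; rewrite /= in_itv /= st ltW.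
rewrite -lenE; have -> : mu `[s, e] = mu (`[s, e]%classic `|` [set 0%R; (2 * pi)%R]).
  apply/esym; apply: (@measureU0 _ _ _ mu) => //.
    by apply: measurableU; exact: measurable_set1.
  apply: countable_lebesgue_measure0; apply: finite_set_countable; exact: finite_set2.
apply: le_measure; rewrite ?inE//; first exact: measurable_arc_angles.
  by apply: measurableU => //; apply: measurableU; exact: measurable_set1.
move=> t [/=]; rewrite in_itv /= => /andP[t0 t2] [x xI xt].
rewrite /= in_itv /= in xI; have xt2 : (`|t - x| <= 2 * pi)%R by rewrite ler_norml; lra.
have [->|tE|tE] := cis_eq_angle (esym xt) xt2.
- by left; rewrite /= in_itv.
- by right; right; rewrite /=; lra.
- by right; left; rewrite /=; lra.
Qed.

(** Otherwise the arc is a point at most, and contains finitely many angles of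
    [0, 2 pi[. *)
Lemma arc_nontrivial J : is_interval J -> (0 < arclength ((@cis R) @` J))%R ->
  exists s e, [/\ (s < e)%R, J s & J e].
Proof.
move=> iJ; apply: contraPP => h.
have [[x Jx]|J0] := pselect (exists x, J x); last first.
  have -> : J = set0 by apply/seteqP; split=> // x Jx; case: J0; exists x.
  by rewrite image_set0 /arclength preimage_set0 setI0 measure0 /= mul0r ltxx.
have -> : J = [set x].
  apply/seteqP; split=> [y Jy|y /= -> //]; case: (ltgtP x y) => //= xy.
    by exfalso; apply: h; exists x, y.
  by exfalso; apply: h; exists y, x.
rewrite image_set1 /arclength (_ : mu _ = 0) /= ?mul0r ?ltxx//.
set A := (_ `&` _); have [[t0 At0]|A0] := pselect (exists t, A t); last first.
  have -> : A = set0 by apply/seteqP; split=> // t At; case: A0; exists t.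
  exact: measure0.
apply: countable_lebesgue_measure0.
apply: (@sub_countable _ _ _ ([set t0; t0 + 2 * pi] `|` [set t0 - 2 * pi])%R).
  apply: subset_card_le => t At.
  move: At At0 => [/=]; rewrite in_itv /= => ti ct [/=]; rewrite in_itv /= => t0i ct0.
  have tt : (`|t - t0| <= 2 * pi)%R by rewrite ler_norml; lra.
  have [->|->|->] := cis_eq_angle (etrans ct (esym ct0)) tt.
  - by left; left.
  - by left; right.
  - by right.
apply: finite_set_countable; rewrite finite_setU; split; [exact: finite_set2|exact: finite_set1].
Qed.

End arcs.

(** * Sectors and dilations *)

Section sectors.
Variable R : realType.
Local Notation mu := (@lebesgue_measure R).
Implicit Types (z : plane R) (J : set R) (s e t m d r rho : R) (I : set (plane R)).

Definition sector I : set (plane R) :=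
  [set z | z <> (0%R, 0%R) /\ I (direction z)].

Lemma cabsE z : cabs z = Num.sqrt (sqnorm z).
Proof. by []. Qed.

Lemma cabs_sqr z : (cabs z ^+ 2 = sqnorm z)%R.
Proof. by rewrite cabsE sqr_sqrtr// sqnorm_ge0. Qed.

Lemma cabs_ge0 z : (0 <= cabs z)%R.
Proof. exact: sqrtr_ge0. Qed.

Lemma cabs_gt0 z : z <> (0%R, 0%R) -> (0 < cabs z)%R.
Proof. by move=> /sqnorm_gt0; rewrite cabsE sqrtr_gt0. Qed.

Lemma sqnorm_direction z : z <> (0%R, 0%R) -> sqnorm (direction z) = 1%R.
Proof.
move=> z0; have := cabs_gt0 z0 => c0.
rewrite /sqnorm /direction /= !expr_div_n -mulrDl -/(sqnorm z) -cabs_sqr divff//.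
by rewrite expf_neq0// gt_eqF.
Qed.

Lemma direction_scale r z : (0 < r)%R ->
  direction ((r * z.1)%R, (r * z.2)%R) = direction z.
Proof.
move=> r0; rewrite /direction /=.
have -> : cabs ((r * z.1)%R, (r * z.2)%R) = (r * cabs z)%R.
  by rewrite /cabs /= !exprMn -mulrDr sqrtrM ?sqr_ge0// sqrtr_sqr gtr0_norm.
by rewrite -!mulf_div !divff ?gt_eqF// !mul1r.
Qed.

Lemma sector_scale I r z : (0 < r)%R ->
  sector I ((r * z.1)%R, (r * z.2)%R) <-> sector I z.
Proof.
move=> r0; rewrite /sector /= direction_scale//; split=> -[z0 Iz]; split=> //.
  by move=> zE; apply: z0; rewrite zE /= mulr0.
move=> [] /eqP; rewrite mulf_eq0 gt_eqF//= => /eqP h1 /eqP.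
by rewrite mulf_eq0 gt_eqF//= => /eqP h2; apply: z0; rewrite [z]surjective_pairing h1 h2.
Qed.

Lemma measurable_direction : measurable_fun [set: plane R] (@direction R : plane R -> plane R).
Proof.
have minv : measurable_fun [set: plane R] (fun z => (cabs z)^-1%R).
  rewrite (_ : (fun z => _) = (@powR R ^~ (- 2^-1)%R) \o (@sqnorm R)).
    by apply: measurableT_comp; [exact: measurable_powR|exact: measurable_sqnorm].
  by apply/funext => z /=; rewrite powRN powR12_sqrt// sqnorm_ge0.
apply/measurable_fun_pairP; split.
- by apply: measurable_funM => //; exact: measurable_fst.
- by apply: measurable_funM => //; exact: measurable_snd.
Qed.

Lemma measurable_origin : measurable [set ((0%R, 0%R) : plane R)].
Proof.
rewrite (_ : [set _] = (@sqnorm R) @^-1` [set 0%R]); last first.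
  apply/seteqP; split=> z /=; last exact: sqnorm_eq0.
  by move=> ->; rewrite /sqnorm /= expr0n addr0.
by rewrite -[X in measurable X]setTI; apply: measurable_sqnorm.
Qed.

Lemma measurable_sector I : measurable I -> measurable (sector I).
Proof.
move=> mI; rewrite (_ : sector I = ~` [set (0%R, 0%R)] `&` (@direction R) @^-1` I).
  apply: measurableI; first by apply: measurableC; exact: measurable_origin.
  rewrite -[X in measurable X]setTI; exact: measurable_direction.
by [].
Qed.

Lemma measurable_scale r : measurable_fun [set: measurableTypeR R]
  (fun x : measurableTypeR R => (r * x)%R : measurableTypeR R).
Proof. by apply: measurable_funM. Qed.

Lemma lebesgue_measure_scale r (A : set (measurableTypeR R)) : (0 < r)%R -> measurable A ->
  mu A = r%:E * mu ((fun x => (r * x)%R) @^-1` A).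
Proof.
move=> r0 mA.
have r0' : (0 <= r)%R by exact: ltW.
pose f := fun x : measurableTypeR R => (r * x)%R : measurableTypeR R.
have mf : measurable_fun setT f by exact: measurable_scale.
pose nu := mscale (NngNum r0')
  (measure_function_pushforward__canonical__measure_function_Measure mu mf).
have := @lebesgue_measure_unique R nu.
move=> /(_ _ A mA); rewrite /nu /mscale /pushforward /=; apply.
move=> _ [[a b] _ <-].
rewrite /= /mscale /= /pushforward.
have -> : f @^-1` `]a, b]%classic = `](a / r)%R, (b / r)%R]%classic :> set R.
  by apply/seteqP; split=> x; rewrite /= !in_itv /= ltr_pdivrMr// ler_pdivlMr// mulrC.
rewrite !lebesgue_measure_itv /= !lte_fin ltr_pM2r ?invr_gt0//.
case: ifPn => _; last by rewrite mule0.
by rewrite -!EFinB -EFinM -mulrBl mulrC divfK// gt_eqF.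
Qed.

Definition dilate r z : plane R := ((r * z.1)%R, (r * z.2)%R).

Lemma measurable_dilate r : measurable_fun [set: plane R] (dilate r).
Proof.
apply/measurable_fun_pairP; split.
- by apply: measurable_funM => //; exact: measurable_fst.
- by apply: measurable_funM => //; exact: measurable_snd.
Qed.

Lemma plane_measure_scale r (E : set (plane R)) : (0 < r)%R -> measurable E ->
  (mu \x mu)%E E = (r ^+ 2)%:E * (mu \x mu)%E (dilate r @^-1` E).
Proof.
move=> r0 mE.
have r0' : (0 <= r ^+ 2)%R by exact: sqr_ge0.
have mf : measurable_fun [set: plane R] (dilate r) by exact: measurable_dilate.
pose nu := mscale (NngNum r0')
  (measure_function_pushforward__canonical__measure_function_Measure (mu \x mu) mf).
have := @product_measure_unique _ _ _ _ R mu mu nu.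
move=> /(_ _ E mE); rewrite /nu /mscale /pushforward /=; apply.
move=> A B mA mB.
rewrite /= /mscale /= /pushforward.
have -> : dilate r @^-1` (A `*` B) =
   ((fun x => (r * x)%R) @^-1` A) `*` ((fun x => (r * x)%R) @^-1` B) by [].
have mr X : measurable X -> measurable ((fun x : measurableTypeR R => (r * x)%R) @^-1` X).
  by move=> mX; rewrite -[X in measurable X]setTI; exact: measurable_scale.
rewrite product_measure1E//; [|exact: mr|exact: mr].
rewrite (lebesgue_measure_scale r0 mA) (lebesgue_measure_scale r0 mB).
by rewrite expr2 EFinM !muleA; congr (_ * _); rewrite -!muleA; congr (_ * _); rewrite muleC.
Qed.

Lemma area_scale r (E : set (plane R)) : (0 < r)%R -> measurable E ->
  area R E = (r ^+ 2)%:E * area R (dilate r @^-1` E).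
Proof.
move=> r0 mE; rewrite /area /= /mscale /= (plane_measure_scale r0 mE).
by rewrite !muleA; congr (_ * _); rewrite muleC.
Qed.

Lemma measurable_ball_sq rho : measurable [set z : plane R | (sqnorm z < rho)%R].
Proof.
rewrite (_ : [set _ | _] = (@sqnorm R) @^-1` `]-oo, rho[); last first.
  by apply/seteqP; split=> z; rewrite /= in_itv.
by rewrite -[X in measurable X]setTI; apply: measurable_sqnorm => //; exact: measurable_itv.
Qed.

Definition aperture I : \bar R :=
  area R (sector I `&` [set z | (sqnorm z < 1)%R]).

(** A sector is invariant under dilations, and a dilation of ratio r multiplies
    areas by r^2. *)
Lemma area_sector_ball I rho : measurable I -> (0 < rho)%R ->
  area R (sector I `&` [set z | (sqnorm z < rho)%R]) = rho%:E * aperture I.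
Proof.
move=> mI rho0; pose r := Num.sqrt rho.
have r0 : (0 < r)%R by rewrite sqrtr_gt0.
have r2 : (r ^+ 2 = rho)%R by rewrite sqr_sqrtr// ltW.
rewrite (area_scale r0); last first.
  by apply: measurableI; [exact: measurable_sector|exact: measurable_ball_sq].
rewrite r2; congr (_ * area R _); apply/seteqP; split=> z /=.
  move=> [/(sector_scale _ _ r0) Sz]; rewrite /sqnorm /dilate /= !exprMn -mulrDr r2.
  by rewrite gtr_pMr// => h; split.
move=> [Sz z1]; split; first exact/sector_scale.
by rewrite /sqnorm /dilate /= !exprMn -mulrDr r2 gtr_pMr.
Qed.

Lemma area_box (a b c d : R) : (a <= b)%R -> (c <= d)%R ->
  area R (`[a, b]%classic `*` `[c, d]%classic) = (pi^-1 * ((b - a) * (d - c)))%:E.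
Proof.
move=> ab cd; rewrite /area /= /mscale /= product_measure1E//.
have itvE (x y : R) : (x <= y)%R -> mu `[x, y] = (y - x)%:E.
  move=> xy; rewrite lebesgue_measure_itv /= lte_fin.
  by case: ltgtP xy => // ->; rewrite subrr.
by rewrite /= !itvE.
Qed.

Lemma sqr_lt1_bound (x : R) : (x ^+ 2 < 1)%R -> (-1 <= x <= 1)%R.
Proof.
move=> h; rewrite -ler_norml -(@ler_pXn2r _ 2)// ?nnegrE// expr1n.
by rewrite real_normK ?num_real// ltW.
Qed.

Lemma aperture_lty I : measurable I -> aperture I < +oo.
Proof.
move=> mI; apply: (@le_lt_trans _ _ (area R (`[(-1)%R, 1%R]%classic `*` `[(-1)%R, 1%R]%classic))).
  apply: le_measure; rewrite ?inE.
  - by apply: measurableI; [exact: measurable_sector|exact: measurable_ball_sq].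
  - by apply: measurableX; exact: measurable_itv.
  move=> z [_] /= z1; have : (z.1 ^+ 2 < 1 /\ z.2 ^+ 2 < 1)%R.
    have := sqr_ge0 (z.1 : R); have := sqr_ge0 (z.2 : R).
    by move: z1; rewrite /sqnorm; lra.
  move=> [h1 h2]; rewrite /= !in_itv /=.
  by split; exact: sqr_lt1_bound.
by rewrite area_box ?ltry//; lra.
Qed.

(** A square around half of the unit vector bisecting the arc lies in the sector.
    Moving by eta in each coordinate changes the inner product with that vector by
    at most 2 eta and keeps the norm below 1/2 + 2 eta; the choice
    16 eta = 1 - c leaves the inner product above c times the norm. *)
Lemma aperture_gt0 J s e : (s < e)%R -> `[s, e] `<=` J -> measurable ((@cis R) @` J) ->
  0 < aperture ((@cis R) @` J).
Proof.
move=> se seJ mJ; pose m := ((s + e) / 2)%R.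
pose c := cos (half_width s e).
have hI := half_width_itv (ltW se).
have h0 : (0 < half_width s e)%R.
  by rewrite /half_width lt_min pi_gt0 andbT; lra.
have c1 : (c < 1)%R.
  by rewrite -cos0 ltr_cos// in_itv /= lexx pi_ge0.
have c2 : (-1 <= c)%R by exact: cos_geN1.
pose eta := ((1 - c) / 16)%R.
have eta0 : (0 < eta)%R by rewrite /eta; lra.
have eta8 : (eta <= 1 / 8)%R by rewrite /eta; lra.
pose X := (cos m / 2)%R; pose Y := (sin m / 2)%R.
pose B : set (plane R) := `[(X - eta)%R, (X + eta)%R]%classic `*`
  `[(Y - eta)%R, (Y + eta)%R]%classic.
apply: (@lt_le_trans _ _ (area R B)).
  rewrite area_box; [|lra|lra].
  rewrite lte_fin mulr_gt0 ?invr_gt0 ?pi_gt0// mulr_gt0//; lra.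
apply: le_measure; rewrite ?inE.
- by apply: measurableX; exact: measurable_itv.
- by apply: measurableI; [exact: measurable_sector|exact: measurable_ball_sq].
move=> z [] /=; rewrite !in_itv /= => z1 z2.
pose p := (z.1 - X)%R; pose q := (z.2 - Y)%R.
have [p1 p2] : (- eta <= p /\ p <= eta)%R by rewrite /p; lra.
have [q1 q2] : (- eta <= q /\ q <= eta)%R by rewrite /q; lra.
have z1E : z.1 = (cos m / 2 + p)%R by rewrite /p /X; ring.
have z2E : z.2 = (sin m / 2 + q)%R by rewrite /q /Y; ring.
pose w := (cos m * p + sin m * q)%R.
have cm := cos2Dsin2 m.
have dE : dot_cis m z = (1 / 2 + w)%R.
  rewrite /dot_cis z1E z2E /w.
  rewrite (_ : (_ + _ = (cos m ^+ 2 + sin m ^+ 2) / 2 + w)%R) /w; first by rewrite cm.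
  by field.
have nE : sqnorm z = (1 / 4 + w + (p ^+ 2 + q ^+ 2))%R.
  rewrite /sqnorm z1E z2E /w.
  rewrite (_ : (_ + _ = (cos m ^+ 2 + sin m ^+ 2) / 4 + w + (p ^+ 2 + q ^+ 2))%R) /w.
    by rewrite cm.
  by field.
have absM (x y : R) : (-1 <= x <= 1)%R -> (- eta <= y)%R -> (y <= eta)%R ->
    (- eta <= x * y <= eta)%R.
  move=> x1 y1 y2; rewrite -ler_norml normrM -[leRHS]mul1r ler_pM// ler_norml//.
  by rewrite y1.
have hcos : (-1 <= cos m <= 1)%R by rewrite cos_geN1 cos_le1.
have hsin : (-1 <= sin m <= 1)%R by rewrite sin_geN1 sin_le1.
have := absM _ _ hcos p1 p2; have := absM _ _ hsin q1 q2 => wq wp.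
have w1 : (- (2 * eta) <= w <= 2 * eta)%R by rewrite /w; lra.
have psq (x : R) : (- eta <= x)%R -> (x <= eta)%R -> (x ^+ 2 <= eta ^+ 2)%R.
  move=> x1 x2; rewrite -(@real_normK _ x) ?num_real// ler_pXn2r// ?nnegrE//.
    by rewrite ler_norml x1.
  exact: ltW.
have p3 := psq p p1 p2; have q3 := psq q q1 q2.
have e2 : (0 <= eta ^+ 2 <= eta / 8)%R.
  by rewrite sqr_ge0 /= expr2 ler_pM2l//; lra.
have n1 : (sqnorm z < 1)%R by rewrite nE; lra.
have cab : (cabs z <= 1 / 2 + 2 * eta)%R.
  rewrite -(@ler_pXn2r _ 2)// ?nnegrE ?cabs_ge0//; last by lra.
  rewrite cabs_sqr nE.
  rewrite (_ : ((1 / 2 + 2 * eta) ^+ 2 = 1 / 4 + 2 * eta + 4 * eta ^+ 2)%R); last by field.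
  lra.
have z0 : z <> (0%R, 0%R).
  by move=> zE; move: dE; rewrite zE /dot_cis /= !mulr0 addr0; lra.
split => //; split => //.
have : ((@cis R) @` `[s, e]) (direction z).
  rewrite (closed_arcE (ltW se)) /=; split; first exact: sqnorm_direction.
  have -> : dot_cis ((s + e) / 2) (direction z) = (dot_cis m z / cabs z)%R.
    by rewrite /dot_cis /direction /= [RHS]mulrDl !mulrA.
  rewrite ler_pdivlMr ?cabs_gt0// -/c dE.
  have [c0|c0] := leP c 0%R.
    have : (c * cabs z <= 0)%R by rewrite mulr_le0_ge0// cabs_ge0.
    lra.
  apply: (@le_trans _ _ (c * (1 / 2 + 2 * eta))%R); first by rewrite ler_pM2l.
  have : (c * eta <= eta)%R by rewrite ler_piMl ?(ltW eta0)// ltW.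
  by rewrite /eta; rewrite /eta in w1; lra.
by move=> [t tI <-]; exists t => //; exact: seJ.
Qed.

End sectors.

(** * Polar coordinates *)

Section polar.
Variable R : realType.
Local Notation mu := (@lebesgue_measure R).
Implicit Types (z : plane R) (x y a b h : R) (I : set (plane R)).

(** The variable in which normalized area becomes Lebesgue measure on ]0, 1[,
    by area_sector_ball. *)
Definition depth z : R := (1 - sqnorm z)%R.

(** Off the sector the value -1 leaves ]0, 1[, so that preimages of subsets of
    ]0, 1[ are intersected with the sector. *)
Definition sector_depth I z : R := ((depth z + 1) * \1_(sector I) z - 1)%R.

Lemma sector_depth_in I z : sector I z -> sector_depth I z = depth z.
Proof. by move=> Sz; rewrite /sector_depth indicE mem_set// mulr1 addrK. Qed.

Lemma sector_depth_out I z : ~ sector I z -> sector_depth I z = (-1)%R.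
Proof. by move=> Sz; rewrite /sector_depth indicE memNset// mulr0 sub0r. Qed.

Lemma measurable_depth : measurable_fun [set: plane R] depth.
Proof. by apply: measurable_funB => //; exact: measurable_sqnorm. Qed.

Lemma measurable_sector_depth I : measurable I ->
  measurable_fun [set: plane R] (sector_depth I).
Proof.
move=> mI; apply: measurable_funB => //; apply: measurable_funM.
  by apply: measurable_funD => //; exact: measurable_depth.
by apply: measurable_indic; exact: measurable_sector.
Qed.

Lemma preimage_sector_depth I (A : set R) : A `<=` `]0%R, 1%R[ ->
  sector_depth I @^-1` A = sector I `&` depth @^-1` A.
Proof.
move=> A01; apply/seteqP; split=> z /=; last first.
  by move=> [Sz]; rewrite sector_depth_in.
have [Sz|Sz] := pselect (sector I z); first by rewrite sector_depth_in.
by rewrite sector_depth_out// => /A01; rewrite /= in_itv /=; lra.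
Qed.

Lemma area_sector_ray I x : measurable I -> (0 <= x)%R ->
  area R (sector I `&` depth @^-1` `]x, 1%R[) = aperture I * mu `]x, 1%R[.
Proof.
move=> mI x0; have [x1|x1] := ltP x 1%R; last first.
  by rewrite set_itv_ge ?bnd_simp -?leNgt// preimage_set0 setI0 !measure0 mule0.
rewrite (lebesgue_itvoo (ltW x1)) muleC -area_sector_ball ?subr_gt0//.
congr (area R _); apply/seteqP; split=> z [Sz] /=; rewrite /depth in_itv /= => zx.
  by split=> //; lra.
by split=> //; have := sqnorm_gt0 Sz.1; lra.
Qed.

Lemma apertureE I : measurable I -> aperture I = (fine (aperture I))%:E.
Proof.
move=> mI; by rewrite fineK// ge0_fin_numE ?aperture_lty//.
Qed.

Lemma fine_aperture_ge0 I : (0 <= fine (aperture I))%R.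
Proof. by apply: fine_ge0; exact: measure_ge0. Qed.

(** Both sides, restricted to ]0, 1[, are finite measures which agree on rays by
    area_sector_ray. *)
Lemma area_sector_depth I (A : set R) : measurable I -> measurable A ->
  A `<=` `]0%R, 1%R[ ->
  pushforward (area R) (sector_depth I) A =
    mscale (NngNum (fine_aperture_ge0 I)) mu A.
Proof.
move=> mI mA A01.
have mf : measurable_fun [set: plane R]
  (sector_depth I : plane R -> measurableTypeR R) := measurable_sector_depth mI.
have m01 : measurable (`]0%R, 1%R[%classic : set (measurableTypeR R)) by exact: measurable_itv.
pose nu := measure_function_pushforward__canonical__measure_function_Measure (area R) mf.
pose m1 := mrestr nu m01.
pose m2 := mrestr (mscale (NngNum (fine_aperture_ge0 I)) mu) m01.
suff : m1 A = m2 A by rewrite /m1 /m2 /mrestr /= setIidl.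
have eqG B : @RGenOInfty.G R B -> m1 B = m2 B.
  move=> [x ->]; rewrite /m1 /m2 /mrestr /=.
  have -> : `]x, +oo[ `&` `]0%R, 1%R[ = `](Num.max x 0%R), 1%R[%classic :> set R.
    apply/seteqP; split=> y; rewrite /= !in_itv /= gt_max.
      by move=> [/andP[-> _] /andP[-> ->]].
    by move=> /andP[/andP[-> ->] ->].
  rewrite /pushforward preimage_sector_depth; last first.
    by move=> y; rewrite /= !in_itv /= gt_max => /andP[/andP[_ ->] ->].
  by rewrite area_sector_ray// ?le_max ?lexx ?orbT// /mscale /= -apertureE.
apply: (@measure_unique _ R (measurableTypeR R) (@RGenOInfty.G R)
  (fun n => `](- n%:R)%R, +oo[%classic)) => //.
- exact: RGenOInfty.measurableE.
- move=> _ _ [x ->] [y ->]; exists (Num.max x y); apply/seteqP; split=> z.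
    by rewrite /= !in_itv /= !andbT gt_max => -[-> ->].
  by rewrite /= !in_itv /= !andbT gt_max => /andP[].
- by move=> n; exists (- n%:R)%R.
- apply/seteqP; split=> // x _; exists (Num.bound `|x|) => //=.
  have h := archi_boundP (normr_ge0 x).
  by rewrite in_itv /= andbT ltrNl (le_lt_trans _ h)// -normrN ler_norm.
- move=> k; have : @RGenOInfty.G R `](- k%:R)%R, +oo[%classic by exists (- k%:R)%R.
  move=> /eqG; rewrite /m1 /= => ->.
  rewrite /m2 /mrestr /= /mscale /=.
  apply: (@le_lt_trans _ _ ((fine (aperture I))%:E * mu `]0%R, 1%R[)).
    apply: lee_wpmul2l; first by rewrite lee_fin fine_aperture_ge0.
    by apply: le_measure; rewrite ?inE//; exact: measurableI.
  by rewrite lebesgue_itvoo// -EFinM ltry.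
Qed.

Lemma nonneg_sector_integral I (D : set R) (phi : R -> \bar R) :
  measurable I -> measurable D -> D `<=` `]0%R, 1%R[ ->
  measurable_fun D phi -> (forall u, D u -> 0 <= phi u) ->
  \int[area R]_(z in sector I `&` depth @^-1` D) phi (depth z) =
    aperture I * \int[mu]_(u in D) phi u.
Proof.
move=> mI mD D01 mphi phi0.
have mf : measurable_fun [set: plane R]
  (sector_depth I : plane R -> measurableTypeR R) := measurable_sector_depth mI.
transitivity (\int[area R]_(z in sector_depth I @^-1` D) (phi \o sector_depth I) z).
  rewrite preimage_sector_depth//; apply: eq_integral => z.
  by rewrite inE => -[Sz _]; rewrite /= sector_depth_in.
rewrite -(ge0_integral_pushforward mf)//; last by move=> u /set_mem; exact: phi0.
transitivity (\int[mscale (NngNum (fine_aperture_ge0 I)) mu]_(u in D) phi u).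
  apply: (@eq_measure_integral _ (measurableTypeR R) R D
    (mscale (NngNum (fine_aperture_ge0 I)) mu)
    (measure_function_pushforward__canonical__measure_function_Measure (area R) mf)).
  move=> A mA AD.
  by apply: area_sector_depth => //; exact: subset_trans D01.
by rewrite ge0_integral_mscale//= -apertureE.
Qed.

Lemma sector_integral I (D : set R) (phi : R -> \bar R) :
  measurable I -> 0 < aperture I -> measurable D -> D `<=` `]0%R, 1%R[ ->
  measurable_fun D phi ->
  \int[area R]_(z in sector I `&` depth @^-1` D) phi (depth z) =
    aperture I * \int[mu]_(u in D) phi u.
Proof.
move=> mI c0 mD D01 mphi.
rewrite integralE [in RHS]integralE.
rewrite (_ : (fun z => phi (depth z))^\+ = fun z => phi^\+ (depth z)); last first.
  by apply/funext => z; rewrite !funeposE.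
rewrite (_ : (fun z => phi (depth z))^\- = fun z => phi^\- (depth z)); last first.
  by apply/funext => z; rewrite !funenegE.
rewrite (nonneg_sector_integral (phi := phi^\+))//; last exact: measurable_funepos.
rewrite (nonneg_sector_integral (phi := phi^\-))//; last exact: measurable_funeneg.
rewrite apertureE// in c0 *; rewrite lte_fin in c0.
have : 0 <= \int[mu]_(u in D) phi^\+ u by apply: integral_ge0.
have : 0 <= \int[mu]_(u in D) phi^\- u by apply: integral_ge0.
case: (\int[mu]_(u in D) phi^\+ u) => [p| |]; case: (\int[mu]_(u in D) phi^\- u) => [n| |] //= _ _.
- by rewrite -!EFinM -!EFinB mulrBr.
- by rewrite !gt0_muley ?gt0_muleNy.
- by rewrite !gt0_muley.
- by rewrite !gt0_muley ?gt0_muleNy.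
Qed.

(** The depth of the circle of radius 1 - h, which bounds a Carleson square of arc
    length h from inside. *)
Definition max_depth h : R := (1 - (1 - h) ^+ 2)%R.

Lemma carleson_squareE I : (arclength I <= 1)%R ->
  carleson_square I = sector I `&` depth @^-1` `]0%R, (max_depth (arclength I))[.
Proof.
move=> h1; apply/seteqP; split=> z /=.
  move=> [dz z0 Iz hz]; split=> //; rewrite in_itv /= /depth -cabs_sqr.
  have c0 := cabs_ge0 z; rewrite /disc /= in dz.
  have : (cabs z ^+ 2 < 1)%R by rewrite expr_lt1.
  have : ((1 - arclength I) ^+ 2 < cabs z ^+ 2)%R.
    by rewrite ltr_pXn2r// ?nnegrE; lra.
  by rewrite /max_depth; lra.
move=> [[z0 Iz]]; rewrite in_itv /= /depth -cabs_sqr => /andP[d0 d1].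
have c0 := cabs_ge0 z; split=> //.
  by rewrite /disc /= -(@expr_lt1 _ 2)//; lra.
have : ((1 - arclength I) ^+ 2 < cabs z ^+ 2)%R.
  by move: d1; rewrite /max_depth; lra.
by rewrite ltr_pXn2r// ?nnegrE; lra.
Qed.

Lemma top_halfE I : (0 <= arclength I <= 1)%R ->
  top_half I = sector I `&`
   depth @^-1` `](max_depth (arclength I / 2)), (max_depth (arclength I))[.
Proof.
move=> /andP[h0 h1]; apply/seteqP; split=> z /=.
  move=> [dz z0 Iz /andP[h2 hz]]; split=> //; rewrite in_itv /= /depth -cabs_sqr.
  have c0 := cabs_ge0 z.
  have : ((1 - arclength I) ^+ 2 < cabs z ^+ 2)%R.
    by rewrite ltr_pXn2r// ?nnegrE; lra.
  have : (cabs z ^+ 2 < (1 - arclength I / 2) ^+ 2)%R.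
    by rewrite ltr_pXn2r// ?nnegrE; lra.
  by rewrite /max_depth; lra.
move=> [[z0 Iz]]; rewrite in_itv /= /depth -cabs_sqr => /andP[d0 d1].
have c0 := cabs_ge0 z.
have : ((1 - arclength I) ^+ 2 < cabs z ^+ 2)%R.
  by move: d1; rewrite /max_depth; lra.
rewrite ltr_pXn2r ?nnegrE//; last by lra.
move=> k1.
have : (cabs z ^+ 2 < (1 - arclength I / 2) ^+ 2)%R.
  by move: d0; rewrite /max_depth; lra.
rewrite ltr_pXn2r ?nnegrE//; last by lra.
move=> k2.
by split=> //; [rewrite /disc /=; lra|lra].
Qed.

Lemma max_depth_itv h : (0 < h <= 1)%R -> (0 < max_depth h <= 1)%R.
Proof.
move=> h01; rewrite /max_depth lerBlDr lerDl sqr_ge0 andbT subr_gt0.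
by rewrite expr_lt1//; lra.
Qed.

Lemma max_depth_surj a : (0 < a <= 1)%R ->
  exists2 h, (0 < h <= 1)%R & max_depth h = a.
Proof.
move=> a01; exists (1 - Num.sqrt (1 - a))%R.
have s0 := sqrtr_ge0 (1 - a)%R.
have s1 : (Num.sqrt (1 - a) < 1)%R.
  by rewrite -[ltRHS]sqrtr1 ltr_sqrt; lra.
  by lra.
by rewrite /max_depth subKr sqr_sqrtr; lra.
Qed.

Lemma circle_arc_measurable I : circle_arc I -> measurable I.
Proof. by move=> [[J [iJ ->]] _]; exact: measurable_arc. Qed.

Lemma circle_arc_aperture I : circle_arc I -> 0 < aperture I.
Proof.
move=> [[J [iJ ->]]] h0; have [s [e [se Js Je]]] := arc_nontrivial iJ h0.
apply: (aperture_gt0 se); last exact: measurable_arc.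
by move=> t; rewrite /= in_itv /=; exact: iJ Js Je t.
Qed.

Lemma circle_arc_length I : circle_arc I -> (0 < arclength I <= 1)%R.
Proof.
move=> aI; apply/andP; split; first exact: aI.2.
by apply: arclength_le1; exact: circle_arc_measurable.
Qed.

Lemma circle_arc_closed s e : (0 <= s)%R -> (s < e)%R -> (e <= 2 * pi)%R ->
  circle_arc ((@cis R) @` `[s, e]).
Proof.
move=> s0 se e2; split.
  by exists `[s, e]%classic; split => //; exact: interval_is_interval.
rewrite arclength_closed_arc// divr_gt0 ?pi2_gt0//; lra.
Qed.

Lemma area_carleson I : circle_arc I ->
  area R (carleson_square I) = aperture I * (max_depth (arclength I))%:E.
Proof.
move=> aI; have hI := circle_arc_length aI; have /andP[h0 h1] := hI.
have /andP[a0 a1] := max_depth_itv hI.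
have sub : `]0%R, (max_depth (arclength I))[ `<=` `]0%R, 1%R[.
  by move=> u; rewrite /= !in_itv /= => /andP[-> /lt_le_trans->].
have mI := circle_arc_measurable aI.
rewrite carleson_squareE// -preimage_sector_depth//.
have := @area_sector_depth I `]0%R, (max_depth (arclength I))[ mI (measurable_itv _) sub.
rewrite /pushforward /mscale /= => ->.
by rewrite lebesgue_itvoo ?(ltW a0)// subr0 -apertureE.
Qed.

(** The aperture of the sector cancels in the quotient, so averages depend on the
    arc only through its length. *)
Lemma avg_carleson I phi (f : plane R -> \bar R) : circle_arc I ->
  measurable_fun (`]0%R, 1%R[%classic : set R) phi ->
  (forall z, carleson_square I z -> f z = phi (depth z)) ->
  avg (carleson_square I) f = mean (max_depth (arclength I)) phi.
Proof.
move=> aI mphi fphi; have hI := circle_arc_length aI; have /andP[h0 h1] := hI.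
have aI01 := max_depth_itv hI; have /andP[a0 a1] := aI01.
set a := max_depth _ in a0 a1 aI01 *.
have mI := circle_arc_measurable aI; have c0 := circle_arc_aperture aI.
rewrite /avg area_carleson// -/a (eq_integral (fun z => phi (depth z))); last first.
  by move=> z /set_mem; exact: fphi.
rewrite carleson_squareE// -/a sector_integral//; last 2 first.
- by move=> u; rewrite /= !in_itv /= => /andP[-> /lt_le_trans->].
- apply: measurable_funS mphi => //.
  by move=> u; rewrite /= !in_itv /= => /andP[-> /lt_le_trans->].
rewrite /mean apertureE// in c0 *; rewrite lte_fin in c0.
set c := fine _ in c0 *.
rewrite -EFinM inver gt_eqF ?mulr_gt0// muleAC -EFinM.
rewrite invfM mulrA mulfV ?gt_eqF// mul1r muleC.
by [].
Qed.

End polar.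

(** * Weights that depend on the depth only *)

Section radial_weights.
Variable R : realType.
Local Notation mu := (@lebesgue_measure R).
Implicit Types (z : plane R) (x y a b h u v r : R) (I : set (plane R)).

Lemma itv_oo_sub x y : (0 <= x)%R -> (y <= 1)%R ->
  (`]x, y[%classic : set R) `<=` `]0%R, 1%R[.
Proof.
move=> x0 y1 u; rewrite /= !in_itv /= => /andP[xu uy].
by rewrite (le_lt_trans x0)// (lt_le_trans uy).
Qed.

(** A region of the sector between two depths has positive area. *)
Lemma ae_sector_witness I (P : plane R -> Prop) x y : circle_arc I ->
  (0 <= x)%R -> (x < y)%R -> (y <= 1)%R -> {ae area R, forall z, P z} ->
  exists z, [/\ sector I z, (x < depth z < y)%R & P z].
Proof.
move=> aI x0 xy y1 [N [mN N0 sub]]; apply: contrapT => h.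
have mI := circle_arc_measurable aI; have c0 := circle_arc_aperture aI.
have sub01 := itv_oo_sub x0 y1.
have : area R (sector_depth I @^-1` `]x, y[) <= area R N.
  apply: le_measure; rewrite ?inE//.
    by rewrite -[X in measurable X]setTI; apply: measurable_sector_depth.
  rewrite preimage_sector_depth// => z [Sz zxy]; apply: sub => Pz.
  by apply: h; exists z; split => //; move: zxy; rewrite /= in_itv.
have := @area_sector_depth R I `]x, y[ mI (measurable_itv _) sub01.
rewrite /pushforward /mscale /= => ->.
rewrite N0 lebesgue_itvoo ?(ltW xy)// -EFinM lee_fin leNgt mulr_gt0 ?subr_gt0//.
by move: c0; rewrite apertureE// lte_fin.
Qed.

Definition arc_of h : set (plane R) := (@cis R) @` `[0%R, (2 * pi * h)%R].

Lemma arc_of_circle_arc h : (0 < h <= 1)%R -> circle_arc (arc_of h).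
Proof.
move=> /andP[h0 h1]; apply: circle_arc_closed => //.
  by rewrite mulr_gt0// pi2_gt0.
by rewrite ler_piMr// ltW// pi2_gt0.
Qed.

Lemma arclength_arc_of h : (0 < h <= 1)%R -> arclength (arc_of h) = h.
Proof.
move=> /andP[h0 h1]; rewrite arclength_closed_arc//.
- by rewrite subr0 mulrAC divff ?mul1r// gt_eqF// pi2_gt0.
- by rewrite mulr_gt0// pi2_gt0.
- by rewrite ler_piMr// ltW// pi2_gt0.
Qed.

(** Every depth bound in ]0, 1] comes from the length of some arc. *)
Lemma forall_arcs (P : R -> Prop) :
  (forall I, circle_arc I -> P (max_depth (arclength I))) <->
  (forall a, (0 < a <= 1)%R -> P a).
Proof.
split=> [h a /max_depth_surj[t t01 <-]|h I aI].
  by rewrite -(arclength_arc_of t01); exact/h/arc_of_circle_arc.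
exact/h/max_depth_itv/circle_arc_length.
Qed.

Lemma disc_depth z : disc R z -> (0 < depth z <= 1)%R.
Proof.
move=> dz; rewrite /depth lerBlDr lerDl sqnorm_ge0 andbT subr_gt0 -cabs_sqr.
by rewrite expr_lt1// cabs_ge0.
Qed.

Lemma carleson_depth I z : carleson_square I z -> disc R z.
Proof. by case. Qed.

Lemma measurable_carleson I : circle_arc I -> measurable (carleson_square I).
Proof.
move=> aI; have mI := circle_arc_measurable aI.
have /andP[h0 h1] := circle_arc_length aI; rewrite carleson_squareE//.
apply: measurableI; first exact: measurable_sector.
rewrite -[X in measurable X]setTI; apply: measurable_depth => //; exact: measurable_itv.
Qed.

Variable w : plane R -> \bar R.
Hypothesis ww : weight w.
Variable g : R -> R.
Hypothesis mg : measurable_fun (`]0%R, 1%R[%classic : set R) g.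
Hypothesis g_gt0 : forall u, (0 < u <= 1)%R -> (0 < g u)%R.
Hypothesis wE : forall z, disc R z -> w z = (g (depth z))%:E.

Let gint := \int[mu]_(u in `]0%R, 1%R[) (g u)%:E < +oo.

Lemma measurable_disc : measurable (disc R).
Proof.
rewrite (_ : disc R = [set z | (sqnorm z < 1)%R]); first exact: measurable_ball_sq.
apply/seteqP; split=> z /=; rewrite /disc /= -cabs_sqr.
  by move=> h; rewrite expr_lt1// cabs_ge0.
by rewrite expr_lt1// cabs_ge0.
Qed.

Lemma integrable_profile : integrable_weight w -> gint.
Proof.
move=> [_ iw]; have h1 : (0 < (1 : R) <= 1)%R by rewrite ltr01 lexx.
have aI := arc_of_circle_arc h1; have lI := arclength_arc_of h1.
set I := arc_of 1 in aI lI.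
have mI := circle_arc_measurable aI; have c0 := circle_arc_aperture aI.
have : (area R).-integrable (carleson_square I) w.
  apply: integrableS iw; [exact: measurable_disc|exact: measurable_carleson|].
  by move=> z; exact: carleson_depth.
move=> /integrableP[_].
rewrite (eq_integral (fun z => (g (depth z))%:E)); last first.
  move=> z /set_mem /carleson_depth dz.
  by rewrite wE// gee0_abs// lee_fin ltW// g_gt0// disc_depth.
rewrite carleson_squareE ?lI// /max_depth subrr expr0n subr0.
rewrite (sector_integral (phi := EFin \o g))//; last exact/measurable_EFinP.
rewrite apertureE// in c0 *; rewrite lte_fin in c0.
rewrite /gint !ltey; apply: contra => /eqP ->.
by rewrite gt0_muley// lte_fin.
Qed.

Lemma avg_profile I (f : plane R -> \bar R) (F : R -> R) : circle_arc I ->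
  measurable_fun [set: R] F ->
  (forall z, disc R z -> f z = (F (g (depth z)))%:E) ->
  avg (carleson_square I) f =
  mean (max_depth (arclength I)) (fun u => (F (g u))%:E).
Proof.
move=> aI mF fF; apply: avg_carleson => //.
  by apply/measurable_EFinP; exact: (measurableT_comp mF mg).
by move=> z /carleson_depth; exact: fF.
Qed.

Lemma avg_weight I : circle_arc I ->
  avg (carleson_square I) w = mean (max_depth (arclength I)) (EFin \o g).
Proof. by move=> aI; rewrite (@avg_profile _ _ id). Qed.

Lemma avg_weight_power I q : circle_arc I ->
  avg (carleson_square I) (fun z => w z `^ q) =
  mean (max_depth (arclength I)) (fun u => (g u `^ q)%:E).
Proof.
move=> aI; apply: (@avg_profile _ _ (@powR R ^~ q)) => //.
by move=> z dz; rewrite wE.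
Qed.

Lemma avg_weight_ln I : circle_arc I ->
  avg (carleson_square I) (fun z => lne (w z)) =
  mean (max_depth (arclength I)) (fun u => (ln (g u))%:E).
Proof.
move=> aI; apply: (@avg_profile I _ (@ln R) aI); first exact: measurable_ln.
by move=> z dz; rewrite wE// lne_EFin// g_gt0// disc_depth.
Qed.

Lemma reverse_holderE : reverse_holder w <-> integrable_weight w /\
  exists q C, [/\ (1 < q)%R, (0 < C)%R & mean_reverse_holder g q C].
Proof.
split=> -[iw [q [C [q1 C0 h]]]]; split=> //; exists q, C; split=> //.
  apply/forall_arcs => I aI.
  by rewrite -avg_weight_power// -avg_weight//; exact: h.
move=> I aI; rewrite avg_weight_power// avg_weight//; apply: h.
exact/max_depth_itv/circle_arc_length.
Qed.

Lemma reverse_jensenE : reverse_jensen w <-> integrable_weight w /\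
  exists2 C, (0 < C)%R & mean_reverse_jensen g C.
Proof.
split=> -[iw [C C0 h]]; split=> //; exists C => //.
  apply/forall_arcs => I aI.
  by rewrite -avg_weight_ln// -avg_weight//; exact: h.
move=> I aI; rewrite avg_weight_ln// avg_weight//; apply: h.
exact/max_depth_itv/circle_arc_length.
Qed.

Lemma B_classE p : (1 < p)%R -> B_class p w <-> integrable_weight w /\
  exists2 C, (0 < C)%R & mean_muckenhoupt g (p - 1)^-1 C.
Proof.
move=> p1; have p10 : (0 < p - 1)%R by rewrite subr_gt0.
have pE : (1 - conj_exponent p = - (p - 1)^-1)%R.
  by rewrite /conj_exponent; field; rewrite gt_eqF.
split=> -[iw [C C0 h]]; split=> //; exists C => //.
  apply/forall_arcs => I aI.
  by rewrite -avg_weight_power// -avg_weight// invrK -pE; exact: h.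
move=> I aI; rewrite avg_weight_power// avg_weight// pE.
by have := h _ (max_depth_itv (circle_arc_length aI)); rewrite invrK.
Qed.

(** * The maximal function *)

Section B_infty.
Hypothesis g_noninc : forall u v, (0 < u)%R -> (u <= v)%R -> (v <= 1)%R ->
  (g v <= g u)%R.

(** The integrand vanishes beyond the depth of I, so the average over the square of
    J is at most mass m / a, where a >= m is the depth of J. *)
Lemma carleson_restrict_avg I J m : circle_arc I -> circle_arc J -> gint ->
  m = Num.min (max_depth (arclength I)) (max_depth (arclength J)) ->
  avg (carleson_square J) (fun z => `|(w \_ (carleson_square I)) z|)
    <= (mass g m / m)%:E.
Proof.
move=> aI aJ gi mE.
have /andP[b0 b1] := max_depth_itv (circle_arc_length aI).
have /andP[a0 a1] := max_depth_itv (circle_arc_length aJ).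
set b := max_depth (arclength I) in b0 b1 mE *.
set a := max_depth (arclength J) in a0 a1 mE *.
have m0 : (0 < m)%R by rewrite mE lt_min b0 a0.
have m1 : (m <= 1)%R by rewrite mE ge_min b1.
have ma : (m <= a)%R by rewrite mE ge_min lexx orbT.
pose phi : R -> \bar R := (EFin \o g) \_ `]0%R, b[.
have mphi : measurable_fun (`]0%R, 1%R[%classic : set R) phi.
  apply/measurable_restrict => //; apply/measurable_EFinP.
  by apply: measurable_funS mg => // u [].
have hJ := circle_arc_length aJ; have hI := circle_arc_length aI.
apply: (@le_trans _ _ (avg (carleson_square J) (fun z => phi (depth z)))).
  rewrite /avg; apply: lee_wpmul2r.
    rewrite inve_ge0; exact: measure_ge0.
  apply: pointwise_le_integral => z Jz; rewrite /phi !patchE.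
  have d01 := disc_depth (carleson_depth Jz).
  case: ifPn => [/set_mem Iz|_]; last first.
    have -> : (point : \bar R) = 0 by [].
    rewrite abse0; case: ifPn => // _.
    by rewrite lee_fin ltW// g_gt0.
  rewrite mem_set.
    rewrite wE; last exact: carleson_depth Jz.
    by rewrite gee0_abs// lee_fin ltW// g_gt0.
  by move: Iz; rewrite carleson_squareE//; [case|case/andP: hI].
rewrite (avg_carleson aJ mphi)// -/a /mean -integral_mkcondr.
have -> : (`]0%R, a[ `&` `]0%R, b[ = `]0%R, m[%classic :> set R).
  apply/seteqP; split=> u; rewrite /= !in_itv /= mE lt_min.
    by move=> [/andP[-> ->] /andP[_ ->]].
  by move=> /andP[-> /andP[-> ->]].
rewrite massE// -EFinM lee_fin ler_pM2l; last by apply: mass_gt0 => //; rewrite m0.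
by rewrite lef_pV2 ?posrE.
Qed.

(** A point z of both squares has depth below m, so the average of the restricted
    weight over the square of J is at most mass m / m <= K g m <= K w z. Thus the
    maximal function is at most K w on the square of I. *)
Lemma dominated_B_infty K : integrable_weight w -> (0 < K)%R ->
  mean_dominated g K -> B_infty w.
Proof.
move=> iw K0 hK; split=> //; have gi := integrable_profile iw.
exists K => // I aI.
have mw : measurable_fun (carleson_square I) w.
  apply: measurable_funS (_ : measurable_fun (disc R) w); first exact: measurable_disc.
    by move=> z; exact: carleson_depth.
  by case: ww.
rewrite -ge0_integralZl//; last 3 first.
- exact: measurable_carleson.
- by move=> z /carleson_depth dz; case: ww => _ + _; apply.
- by rewrite lee_fin ltW.
apply: pointwise_le_integral => z Iz.
have dz := disc_depth (carleson_depth Iz).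
apply: ge_ereal_sup => _ [J [aJ Jz] <-].
apply: (le_trans (carleson_restrict_avg aI aJ gi erefl)).
have /andP[b0 b1] := max_depth_itv (circle_arc_length aI).
have /andP[a0 a1] := max_depth_itv (circle_arc_length aJ).
set m := Num.min _ _.
have m0 : (0 < m)%R by rewrite /m lt_min b0 a0.
have m1 : (m <= 1)%R by rewrite /m ge_min b1.
rewrite wE; last exact: carleson_depth Iz.
rewrite -EFinM lee_fin ler_pdivrMr//.
have := hK m; rewrite m0 m1 => /(_ isT) /le_trans; apply.
rewrite mulrAC -mulrA ler_pM2l// ler_pM2l//; apply: g_noninc => //.
  by case/andP: dz.
have lI : (arclength I <= 1)%R by case/andP: (circle_arc_length aI).
have lJ : (arclength J <= 1)%R by case/andP: (circle_arc_length aJ).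
rewrite /m le_min; apply/andP; split; apply: ltW.
  by move: Iz; rewrite carleson_squareE// => -[_]; rewrite /= in_itv /= => /andP[].
by move: Jz; rewrite carleson_squareE// => -[_]; rewrite /= in_itv /= => /andP[].
Qed.

(** Each of the n dyadic pieces contributes at least 1/2; this replaces the
    logarithm of 2^n. *)
Lemma integral_inv_dyadic a n : (0 < a)%R ->
  (n%:R / 2)%:E <= \int[mu]_(u in `[(a / 2 ^+ n)%R, a[) (u `^ (-1))%:E.
Proof.
move=> a0; elim: n => [|n IH].
  by rewrite mul0r; apply: integral_ge0 => u _; rewrite lee_fin powR_ge0.
have p0 : (0 < a / 2 ^+ n.+1)%R by rewrite divr_gt0// exprn_gt0.
have p1 : (a / 2 ^+ n = 2 * (a / 2 ^+ n.+1))%R.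
  by rewrite exprS; field; rewrite expf_neq0// pnatr_eq0.
have p2 : (a / 2 ^+ n <= a)%R.
  by rewrite ler_pdivrMr ?exprn_gt0// ler_peMr ?(ltW a0)// exprn_ege1// ler1n.
have -> : (`[(a / 2 ^+ n.+1)%R, a[%classic : set R) =
    `[(a / 2 ^+ n.+1)%R, (a / 2 ^+ n)%R[ `|` `[(a / 2 ^+ n)%R, a[.
  by rewrite -itv_bndbnd_setU// bnd_simp//; lra.
rewrite ge0_integral_setU//=; last 3 first.
- by apply/measurable_EFinP; apply: measurable_funTS; exact: measurable_powR.
- by move=> u _; rewrite lee_fin powR_ge0.
- apply/disj_setPS => u [] /=; rewrite !in_itv /= => /andP[_ ub] /andP[bu _].
  by move: (lt_le_trans ub bu); rewrite ltxx.
rewrite -natr1 mulrDl addrC EFinD; apply: leeD => //.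
apply: (@le_trans _ _ (\int[mu]_(u in `[(a / 2 ^+ n.+1)%R, (a / 2 ^+ n)%R[) ((a / 2 ^+ n)^-1)%:E)).
  rewrite integral_cst//= lebesgue_itvco; last by lra.
  rewrite -EFinM lee_fin p1 mul1r le_eqVlt; apply/orP; left; apply/eqP.
  by move: p0; set p := (a / 2 ^+ n.+1)%R => p0; field; rewrite gt_eqF.
apply: pointwise_le_integral => u; rewrite /= in_itv /= => /andP[u1 u2].
have u0 : (0 < u)%R by exact: lt_le_trans u1.
by rewrite lee_fin powR_inv1 ?(ltW u0)// lef_pV2 ?posrE ?(ltW u2)//; lra.
Qed.

Lemma maximal_ge0 I f z : circle_arc I -> carleson_square I z -> 0 <= maximal f z.
Proof.
move=> aI Iz; apply: (@le_trans _ _ (avg (carleson_square I) (fun z' => `|f z'|))).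
  by rewrite /avg mule_ge0 ?inve_ge0 ?measure_ge0// integral_ge0.
by apply: ereal_sup_ubound; exists I.
Qed.

Lemma max_depth_mono h h' : (0 <= h <= 1)%R -> (0 <= h' <= 1)%R ->
  (max_depth h <= max_depth h')%R = (h <= h')%R.
Proof.
move=> h01 h01'; rewrite /max_depth lerD2l lerN2 ler_pXn2r ?nnegrE//; lra.
Qed.

(** The arc of length h' starting at the angle of z, pushed back when it would
    leave the large arc. *)
Lemma subarc_through h h' z : (0 < h' <= h)%R -> (h <= 1)%R ->
  arc_of h (direction z) ->
  exists J, [/\ circle_arc J, arclength J = h', J `<=` arc_of h & J (direction z)].
Proof.
move=> /andP[h0 hh'] h1 [t]; rewrite /= in_itv /= => /andP[t0 th] tz.
have p0 := @pi2_gt0 R.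
pose s := Num.min t (2 * pi * (h - h'))%R.
have s0 : (0 <= s)%R by rewrite /s le_min t0 mulr_ge0 ?(ltW p0)// subr_ge0.
have s1 : (s <= 2 * pi * (h - h'))%R by rewrite /s ge_min lexx orbT.
have s2 : (s <= t)%R by rewrite /s ge_min lexx.
have ph : (0 < 2 * pi * h')%R by rewrite mulr_gt0.
have ph1 : (2 * pi * h <= 2 * pi)%R by rewrite ler_piMr// ltW.
have s3 : (t <= s + 2 * pi * h')%R.
  rewrite /s; case: (leP t (2 * pi * (h - h'))%R) => _; lra.
have e1 : (s + 2 * pi * h' <= 2 * pi * h)%R by lra.
exists ((@cis R) @` `[s, (s + 2 * pi * h')%R]); split.
- by apply: circle_arc_closed => //; lra.
- rewrite arclength_closed_arc//; [|lra|lra].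
  by rewrite addrAC subrr add0r mulrAC divff ?mul1r// gt_eqF.
- move=> _ [x + <-]; rewrite /= in_itv /= => xI.
  by exists x => //; rewrite /= in_itv /=; lra.
- by exists t => //; rewrite /= in_itv /= s2.
Qed.

(** At a point of depth u between e a and a, the Carleson square on a subarc, of
    dyadic depth b with u < b <= 2 u, shows that the maximal function is at least
    B / (2 u), where B = mass (e a). Integrating, N / 4 times B is at most
    C mass a, so that B <= mass a / 2 once N >= 8 C. *)
Lemma B_infty_dominated : B_infty w -> exists2 K, (0 < K)%R & mean_dominated g K.
Proof.
move=> [iw [C C0 h]]; have gi := integrable_profile iw.
pose N := (Num.bound (8 * C)).+1.
have NC : (8 * C <= N%:R)%R.
  have /ltW hb : (8 * C < (Num.bound (8 * C))%:R)%R.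
    by apply: archi_boundP; rewrite mulr_ge0// ltW.
  by rewrite (le_trans hb)// ler_nat.
pose e := ((2 ^+ N)^-1 : R)%R.
have e01 : (0 < e < 1)%R.
  rewrite /e invr_gt0 exprn_gt0//= invf_lt1 ?exprn_gt0//.
  by rewrite exprn_egt1// ltr1n.
have /andP[e0 e1] := e01.
apply: (mean_dominated_half mg g_gt0 gi g_noninc e01) => a a01.
have /andP[a0 a1] := a01.
have [t t01 ta] := max_depth_surj a01.
have aI := arc_of_circle_arc t01; have lI := arclength_arc_of t01.
have /andP[t0 t1] := t01.
set I := arc_of t in aI lI.
have mI := circle_arc_measurable aI; have c0 := circle_arc_aperture aI.
have ea : (0 < e * a <= a)%R by rewrite mulr_gt0//= ler_piMl// ltW.
have /andP[ea0 eaa] := ea.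
have B0 : (0 < mass g (e * a))%R by apply: mass_gt0 => //; rewrite ea0 (le_trans eaa).
set B := mass g (e * a) in B0 *.
have sub1 : `[(e * a)%R, a[ `<=` `]0%R, 1%R[.
  by move=> u; rewrite /= !in_itv /= => /andP[/(lt_le_trans ea0)-> /lt_le_trans->].
have subQ z : (sector I `&` (@depth R) @^-1` `[(e * a)%R, a[) z -> carleson_square I z.
  move=> [Sz]; rewrite /= in_itv /= => /andP[d1 d2].
  rewrite carleson_squareE lI// ta; split=> //.
  by rewrite /= in_itv /= d2 andbT (lt_le_trans ea0).
have lower z : (sector I `&` (@depth R) @^-1` `[(e * a)%R, a[) z ->
    (B / 2)%:E * ((depth z) `^ (-1))%:E <= maximal (w \_ (carleson_square I)) z.
  move=> Az; have Iz := subQ z Az; move: Az => [Sz]; rewrite /= in_itv /= => /andP[d1 d2].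
  have d0 : (0 < depth z)%R := lt_le_trans ea0 d1.
  have [k /andP[k1 k2]] := @dyadic_cover R a (depth z) (introT andP (conj d0 d2)).
  set b := (a / 2 ^+ k)%R in k2.
  have bE : (a / 2 ^+ k.+1 = b / 2)%R by rewrite exprSr invfM mulrA.
  rewrite bE in k1.
  have ba : (b <= a)%R.
    by rewrite /b ler_pdivrMr ?exprn_gt0// ler_peMr ?(ltW a0)// exprn_ege1// ler1n.
  have b0 : (0 < b)%R := lt_trans d0 k2.
  have b01 : (0 < b <= 1)%R by rewrite b0 (le_trans ba).
  have [h' h'01 hb] := max_depth_surj b01.
  have /andP[h'0 h'1] := h'01.
  have h't : (h' <= t)%R by rewrite -max_depth_mono ?hb ?ta// ?(ltW h'0) ?(ltW t0).
  have [J [aJ lJ JI Jz]] := @subarc_through t h' z (introT andP (conj h'0 h't)) t1 Sz.2.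
  have QJ : carleson_square J `<=` carleson_square I.
    move=> z' [dz' z'0 Jz' hz']; split=> //; first exact: JI.
    by rewrite lI (lt_le_trans hz')// lJ.
  have Qz : carleson_square J z.
    rewrite carleson_squareE ?lJ// hb; split; first by split=> //; case: Sz.
    by rewrite /= in_itv /= d0.
  apply: (@le_trans _ _ (avg (carleson_square J)
      (fun z' => `|(w \_ (carleson_square I)) z'|))); last first.
    by apply: ereal_sup_ubound; exists J.
  rewrite (@avg_carleson R J (EFin \o g))//; last 2 first.
  - exact/measurable_EFinP.
  - move=> z' Jz'; have dz' := carleson_depth Jz'.
    rewrite patchE mem_set; last exact: QJ.
    by rewrite wE// gee0_abs// lee_fin ltW// g_gt0// disc_depth.
  rewrite lJ hb mean_massE ?(le_trans ba)//.
  rewrite -EFinM lee_fin powR_inv1 ?(ltW d0)//.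
  have BM : (B <= mass g b)%R.
    apply: mass_le => //; last by rewrite (le_trans ba).
    by rewrite ea0 (le_trans d1)// ltW.
  rewrite ler_pdivrMr// mulrAC ler_pdivlMr//.
  apply: (@le_trans _ _ (B * depth z)%R); last by rewrite ler_pM2r.
  by rewrite mulrAC -mulrA ler_pM2l//; lra.
have := h I aI.
rewrite (_ : \int[area R]_(z in carleson_square I) w z = aperture I * (mass g a)%:E); last first.
  rewrite (eq_integral (fun z => (EFin \o g) (depth z))); last first.
    by move=> z /set_mem /carleson_depth dz; rewrite wE.
  have sub0 : `]0%R, a[ `<=` `]0%R, 1%R[ by exact: itv_oo_sub.
  rewrite carleson_squareE ?lI// ta.
  rewrite (@sector_integral R I `]0%R, a[%classic (EFin \o g))//; last first.
    by apply/measurable_EFinP; apply: measurable_funS mg.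
  by rewrite (massE mg g_gt0 gi a1).
have : \int[area R]_(z in sector I `&` (@depth R) @^-1` `[(e * a)%R, a[)
     ((B / 2)%:E * ((depth z) `^ (-1))%:E) <=
   \int[area R]_(z in carleson_square I) maximal (w \_ (carleson_square I)) z.
  rewrite integral_mkcond [leRHS]integral_mkcond.
  apply: pointwise_le_integral => z _; rewrite !patchE.
  case: ifPn => [/set_mem Az|_].
    by rewrite mem_set; [exact: lower|exact: subQ].
  by case: ifPn => // /set_mem Iz; exact: maximal_ge0 aI Iz.
have mpow : measurable_fun (`[(e * a)%R, a[%classic : set R)
    (fun u : R => (u `^ (-1))%:E).
  by apply/measurable_EFinP; apply: measurable_funTS; exact: measurable_powR.
rewrite (@sector_integral R I `[(e * a)%R, a[%classic
  (fun u => (B / 2)%:E * (u `^ (-1))%:E))//; last exact: measurable_funeM.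
move=> h1 h2; have := le_trans h1 h2.
rewrite ge0_integralZl//; last 2 first.
- by move=> u _; rewrite lee_fin powR_ge0.
- by rewrite lee_fin divr_ge0// ltW.
have low := @integral_inv_dyadic a N a0.
rewrite (_ : a / 2 ^+ N = e * a)%R in low; last by rewrite mulrC.
move=> h3.
have : aperture I * ((B / 2)%:E * (N%:R / 2)%:E) <= C%:E * (aperture I * (mass g a)%:E).
  apply: le_trans h3; apply: lee_wpmul2l; first exact: ltW.
  by apply: lee_wpmul2l => //; rewrite lee_fin divr_ge0// ltW.
rewrite apertureE// in c0 *; rewrite lte_fin in c0; set c := fine _ in c0 *.
rewrite -!EFinM lee_fin (mulrCA C c) ler_pM2l// => h4.
have h5 : (8 * C * B <= N%:R * B)%R by rewrite ler_pM2r.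
have h6 : (B / 2 * (N%:R / 2) = N%:R * B / 4)%R by field.
have h7 : (C * (2 * B) <= C * mass g a)%R.
  by rewrite mulrCA; rewrite h6 in h4; lra.
rewrite ler_pM2l// in h7; lra.
Qed.

End B_infty.

(** * Top halves *)

Section top_halves.
Hypothesis g_nondec : forall u v, (0 < u)%R -> (u <= v)%R -> (v <= 1)%R ->
  (g u <= g v)%R.

Lemma nondecreasing_integrable : integrable_weight w /\ gint.
Proof.
have g1 : (0 < g 1)%R by apply: g_gt0; rewrite ltr01 lexx.
suff iw : integrable_weight w by split=> //; exact: integrable_profile.
split=> //; case: ww => mw w0 _; apply/integrableP; split=> //.
apply: (@le_lt_trans _ _ (\int[area R]_(z in disc R) (g 1)%:E)).
  apply: pointwise_le_integral => z dz; have /andP[d0 d1] := disc_depth dz.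
  rewrite wE// gee0_abs ?lee_fin; last by rewrite ltW// g_gt0// d0.
  exact: g_nondec.
rewrite integral_cst; last exact: measurable_disc.
apply: (@le_lt_trans _ _ ((g 1)%:E * area R (`[(-1)%R, 1%R]%classic `*` `[(-1)%R, 1%R]%classic))).
  apply: lee_wpmul2l; first by rewrite lee_fin ltW.
  apply: le_measure; rewrite ?inE; [exact: measurable_disc| |].
    by apply: measurableX; exact: measurable_itv.
  move=> z /disc_depth; rewrite /depth /sqnorm => /andP[dz _].
  have := sqr_ge0 (z.1 : R); have := sqr_ge0 (z.2 : R) => s1 s2.
  by rewrite /= !in_itv /=; split; apply: sqr_lt1_bound; lra.
by rewrite area_box -?EFinM ?ltry//; lra.
Qed.

(** On a top half the depth lies between max_depth h / 2 and max_depth h. *)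
Lemma doubling_top_halves K : (1 < K)%R -> doubling g K -> almost_constant_top_halves w.
Proof.
move=> K1 hK; exists K; first exact: ltW.
move=> I aI; have hI := circle_arc_length aI; have /andP[h0 h1] := hI.
set h := arclength I in hI h0 h1.
have a01 := max_depth_itv hI; have /andP[a0 a1] := a01.
have depthT z : top_half I z ->
    [/\ disc R z, (max_depth h / 2 <= depth z)%R & (depth z <= max_depth h)%R].
  move=> Tz; split; first by case: Tz.
    move: Tz; rewrite top_halfE ?(ltW h0)//= => -[_]; rewrite in_itv /= -/h => /andP[h2 _].
    apply: le_trans (ltW h2); rewrite /max_depth.
    have -> : ((1 - (1 - h) ^+ 2) / 2 = h - h ^+ 2 / 2)%R by field.
    have -> : (1 - (1 - h / 2) ^+ 2 = h - h ^+ 2 / 4)%R by field.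
    by have := sqr_ge0 h; lra.
  by move: Tz; rewrite top_halfE ?(ltW h0)//= => -[_]; rewrite in_itv /= -/h => /andP[_ /ltW].
apply: (@le_trans _ _ (g (max_depth h))%:E).
  apply/ess_supP; apply: aeW => z /=; rewrite /patch; case: ifPn => [/set_mem|_]; last exact: leNye.
  move=> /depthT[dz d1 d2]; rewrite wE// lee_fin; apply: g_nondec => //.
  by case/andP: (disc_depth dz).
apply: (@le_trans _ _ (K%:E * (g (max_depth h / 2))%:E)).
  by rewrite -EFinM lee_fin; exact: hK.
apply: lee_wpmul2l; first by rewrite lee_fin; lra.
apply/ess_infP; apply: aeW => z /=; rewrite /patch; case: ifPn => [/set_mem|_]; last exact: leey.
move=> /depthT[dz d1 d2]; rewrite wE// lee_fin; apply: g_nondec => //; first by lra.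
by case/andP: (disc_depth dz).
Qed.

Lemma max_depth_lt h h' : (0 <= h <= 1)%R -> (0 <= h' <= 1)%R ->
  (max_depth h < max_depth h')%R = (h < h')%R.
Proof.
move=> h01 h01'; rewrite ltNge max_depth_mono ?ltNge//.
Qed.

(** By monotonicity the essential supremum is at least the value at any interior
    depth of the top half, and the essential infimum at most. *)
Lemma top_halves_compare C : (1 <= C)%R -> (forall I, circle_arc I ->
    ess_sup_on (top_half I) w <= C%:E * ess_inf_on (top_half I) w) ->
  forall h s t, (0 < h <= 1)%R -> (h / 2 < s)%R -> (s < h)%R ->
    (h / 2 < t)%R -> (t < h)%R -> (g (max_depth t) <= C * g (max_depth s))%R.
Proof.
move=> C1 acth h s t h01 s1 s2 t1 t2; have /andP[h0 h1] := h01.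
have aI := arc_of_circle_arc h01; have lI := arclength_arc_of h01.
have s01 : (0 <= s <= 1)%R by lra.
have t01 : (0 <= t <= 1)%R by lra.
have h01' : (0 <= h <= 1)%R by lra.
have h201 : (0 <= h / 2 <= 1)%R by lra.
have d0 : (0 <= max_depth (h / 2))%R.
  by case/andP: (@max_depth_itv R (h / 2) ltac:(lra)) => /ltW.
have d1 : (max_depth h <= 1)%R by case/andP: (max_depth_itv h01).
have ds1 : (max_depth (h / 2) < max_depth s)%R by rewrite max_depth_lt.
have ds2 : (max_depth s < max_depth h)%R by rewrite max_depth_lt.
have dt1 : (max_depth (h / 2) < max_depth t)%R by rewrite max_depth_lt.
have dt2 : (max_depth t < max_depth h)%R by rewrite max_depth_lt.
have inT z : sector (arc_of h) z -> (max_depth (h / 2) < depth z < max_depth h)%R ->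
    z \in top_half (arc_of h) /\ disc R z.
  move=> Sz dz; have Tz : top_half (arc_of h) z.
    by rewrite top_halfE lI ?(ltW h0)//; split => //; rewrite /= in_itv.
  by split; [rewrite inE|case: Tz].
have supge : (g (max_depth t))%:E <= ess_sup_on (top_half (arc_of h)) w.
  have [z [Sz dz zle]] := ae_sector_witness aI (le_trans d0 (ltW dt1)) dt2 d1
    (ess_sup_ge (area R) (patch (cst -oo) (top_half (arc_of h)) w)).
  apply: le_trans zle; have [|Tz dz'] := inT z Sz; first by lra.
  rewrite /patch Tz wE// lee_fin; apply: g_nondec; lra.
have infle : ess_inf_on (top_half (arc_of h)) w <= (g (max_depth s))%:E.
  have [z [Sz dz zle]] := ae_sector_witness aI d0 ds1 (le_trans (ltW ds2) d1)
    (ess_inf_le (area R) (patch (cst +oo) (top_half (arc_of h)) w)).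
  apply: (le_trans zle); have [|Tz dz'] := inT z Sz; first by lra.
  rewrite /patch Tz wE// lee_fin; apply: g_nondec; lra.
rewrite -lee_fin EFinM; apply: (le_trans supge); apply: (le_trans (acth _ aI)).
by apply: lee_wpmul2l => //; rewrite lee_fin; lra.
Qed.

(** The top half over an arc of length 7 t / 4 contains points with 1 - |z| equal to
    t and to 3 t / 2. Four such steps multiply t by 81/16 >= 4, and halving the
    depth divides 1 - |z| by at most 4. *)
Lemma top_halves_doubling : almost_constant_top_halves w ->
  exists2 K, (1 < K)%R & doubling g K.
Proof.
move=> [C C1 /(top_halves_compare C1) cmp].
pose F t := g (max_depth t).
have C0 : (0 < C)%R by lra.
have step t : (0 < t <= 2^-1)%R -> (F (3 / 2 * t) <= C * F t)%R.
  by move=> t01; apply: (cmp (7 / 4 * t)%R); lra.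
have monoF s t : (0 < s)%R -> (s <= t)%R -> (t <= 1)%R -> (F s <= F t)%R.
  move=> s0 st t1; apply: g_nondec.
  - by case/andP: (@max_depth_itv R s ltac:(lra)).
  - by rewrite max_depth_mono//; lra.
  - by case/andP: (@max_depth_itv R t ltac:(lra)).
have quad t : (0 < t <= 1 / 8)%R -> (F (4 * t) <= C ^+ 4 * F t)%R.
  move=> t01; apply: (@le_trans _ _ (F (3 / 2 * (3 / 2 * (3 / 2 * (3 / 2 * t)))))%R).
    by apply: monoF; lra.
  have s4 : (F (3 / 2 * (3 / 2 * (3 / 2 * (3 / 2 * t)))) <=
     C * F (3 / 2 * (3 / 2 * (3 / 2 * t))))%R by apply: step; lra.
  have s3 : (F (3 / 2 * (3 / 2 * (3 / 2 * t))) <= C * F (3 / 2 * (3 / 2 * t)))%R.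
    by apply: step; lra.
  have s2 : (F (3 / 2 * (3 / 2 * t)) <= C * F (3 / 2 * t))%R by apply: step; lra.
  have s1 : (F (3 / 2 * t) <= C * F t)%R by apply: step; lra.
  have -> : (C ^+ 4 * F t = C * (C * (C * (C * F t))))%R by ring.
  apply: (le_trans s4); rewrite ler_pM2l//; apply: (le_trans s3).
  by rewrite ler_pM2l//; apply: (le_trans s2); rewrite ler_pM2l.
have d01 : (0 < (2^-1 : R) <= 1)%R by lra.
apply: (doubling_near0 g_gt0 g_nondec d01 (exprn_gt0 4 C0)) => a a01.
have a1 : (0 < a <= 1)%R by lra.
have a21 : (0 < a / 2 <= 1)%R by lra.
have [t t01 ta] := max_depth_surj a1; have [s s01 sa] := max_depth_surj a21.
have := sqr_ge0 t; have := sqr_ge0 s => sq_s sq_t.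
have taE : (2 * t - t ^+ 2 = a)%R by rewrite -ta /max_depth; ring.
have saE : (2 * s - s ^+ 2 = a / 2)%R by rewrite -sa /max_depth; ring.
have tt : (t ^+ 2 <= t)%R by rewrite expr2 ler_piMl; lra.
rewrite -sa -ta -/(F t) -/(F s).
have -> : t = (4 * (t / 4))%R by field.
apply: (le_trans (quad (t / 4)%R _)); first by lra.
rewrite ler_pM2l ?exprn_gt0//; apply: monoF; lra.
Qed.

End top_halves.

End radial_weights.

(** * Monotone radial weights *)

Section monotone_profile.
Variable R : realType.
Local Notation mu := (@lebesgue_measure R).
Implicit Types (z : plane R) (u v r s : R).

Variables (w : plane R -> \bar R) (f : R -> \bar R).
Hypothesis ww : weight w.
Hypothesis wf : radial_profile w f.
Hypothesis w0 : 0 < w (0%R, 0%R) < +oo.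

(** The radius at depth u is sqrt (1 - u). *)
Definition depth_profile u : R := fine (f (Num.sqrt (1 - u))).

Let itv_sqrt u : (0 < u <= 1)%R -> Num.sqrt (1 - u)%R \in `[0%R, 1%R[.
Proof.
move=> u01; rewrite in_itv /= sqrtr_ge0 /= -[ltRHS]sqrtr1 ltr_sqrt; lra.
Qed.

Lemma measurable_depth_profile :
  measurable_fun (`]0%R, 1%R[%classic : set R) depth_profile.
Proof.
case: wf => mf _ _; have mf' : measurable_fun (`[0%R, 1%R[%classic : set R) (fine \o f).
  by apply: measurableT_comp => //; exact: fine_measurable.
apply: (measurable_comp _ _ mf') => //.
  move=> _ [u + <-]; rewrite /= in_itv /= => /andP[u0 u1].
  by apply: itv_sqrt; rewrite u0 ltW.
apply: measurable_funTS; apply: measurableT_comp.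
  by apply: continuous_measurable_fun; exact: sqrt_continuous.
exact: measurable_funB.
Qed.

(** The annulus from r to 1 has positive area, and a weight is almost everywhere
    positive and finite. *)
Lemma profile_witness r : r \in `[0%R, 1%R[ ->
  exists s, [/\ s \in `[0%R, 1%R[, (r <= s)%R & 0 < f s < +oo].
Proof.
rewrite in_itv /= => /andP[r0 r1]; case: ww => _ _ aew.
have h1 : (0 < (1 : R) <= 1)%R by rewrite ltr01 lexx.
have aI := arc_of_circle_arc h1.
have r2 : (0 < 1 - r ^+ 2)%R by rewrite subr_gt0 expr_lt1.
have r2' : (1 - r ^+ 2 <= 1)%R by rewrite lerBlDr lerDl sqr_ge0.
have [z [Sz /andP[d0 d1] Pz]] := ae_sector_witness aI (lexx _) r2 r2' aew.
have c0 := cabs_ge0 z.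
have c1 : (cabs z < 1)%R.
  by rewrite -(@expr_lt1 _ 2)// cabs_sqr; move: d0; rewrite /depth; lra.
exists (cabs z); split; first by rewrite in_itv /= c0.
  rewrite -(@ler_pXn2r _ 2)// ?nnegrE// cabs_sqr.
  by move: d1; rewrite /depth; lra.
by case: wf => _ _ <-//; exact: Pz.
Qed.

Lemma profile0 : 0 < f 0%R < +oo.
Proof.
have c0 : cabs ((0%R, 0%R) : plane R) = 0%R.
  by rewrite /cabs /= expr0n addr0 sqrtr0.
case: wf => _ _ h; rewrite -c0 -h//.
by rewrite /disc /= c0.
Qed.

Lemma profileE (fin : forall r, r \in `[0%R, 1%R[ -> 0 < f r < +oo) z :
  disc R z -> w z = (depth_profile (depth z))%:E.
Proof.
move=> dz; case: wf => _ _ h; rewrite h// /depth_profile /depth subKr -cabsE.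
have cI : cabs z \in `[0%R, 1%R[ by rewrite in_itv /= cabs_ge0.
have /andP[f0 f1] := fin _ cI.
by rewrite fineK// ge0_fin_numE// ltW.
Qed.

Lemma depth_profile_gt0 (fin : forall r, r \in `[0%R, 1%R[ -> 0 < f r < +oo) u :
  (0 < u <= 1)%R -> (0 < depth_profile u)%R.
Proof. by move=> u01; rewrite /depth_profile fine_gt0// fin// itv_sqrt. Qed.

Lemma increasing_profile_fin :
  {in `[0%R, 1%R[ &, {homo f : r s / (r <= s)%R >-> r <= s}} ->
  forall r, r \in `[0%R, 1%R[ -> 0 < f r < +oo.
Proof.
move=> fincr r rI; have [s [sI rs /andP[_ sfin]]] := profile_witness rI.
have /andP[f0 _] := profile0.
rewrite (le_lt_trans _ sfin) ?andbT; last exact: fincr.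
apply: (lt_le_trans f0); apply: fincr => //; first by rewrite in_itv /= lexx ltr01.
by move: rI; rewrite in_itv => /andP[].
Qed.

Lemma decreasing_profile_fin :
  {in `[0%R, 1%R[ &, {homo f : r s / (r <= s)%R >-> s <= r}} ->
  forall r, r \in `[0%R, 1%R[ -> 0 < f r < +oo.
Proof.
move=> fdecr r rI; have [s [sI rs /andP[sfin _]]] := profile_witness rI.
have /andP[_ f0] := profile0.
rewrite (lt_le_trans sfin) /=; last exact: fdecr.
apply: le_lt_trans f0; apply: fdecr => //; first by rewrite in_itv /= lexx ltr01.
by move: rI; rewrite in_itv => /andP[].
Qed.

Lemma depth_profile_noninc :
  {in `[0%R, 1%R[ &, {homo f : r s / (r <= s)%R >-> r <= s}} ->
  forall u v, (0 < u)%R -> (u <= v)%R -> (v <= 1)%R ->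
  (depth_profile v <= depth_profile u)%R.
Proof.
move=> fincr u v u0 uv v1; have fin := increasing_profile_fin fincr.
have uI : Num.sqrt (1 - u)%R \in `[0%R, 1%R[ by apply: itv_sqrt; rewrite u0 (le_trans uv).
have vI : Num.sqrt (1 - v)%R \in `[0%R, 1%R[ by apply: itv_sqrt; rewrite v1 (lt_le_trans u0).
have /andP[u1 u2] := fin _ uI; have /andP[v1' v2] := fin _ vI.
apply: fine_le; [by rewrite ge0_fin_numE// ltW|by rewrite ge0_fin_numE// ltW|].
by apply: fincr => //; apply: ler_wsqrtr; lra.
Qed.

Lemma depth_profile_nondec :
  {in `[0%R, 1%R[ &, {homo f : r s / (r <= s)%R >-> s <= r}} ->
  forall u v, (0 < u)%R -> (u <= v)%R -> (v <= 1)%R ->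
  (depth_profile u <= depth_profile v)%R.
Proof.
move=> fdecr u v u0 uv v1; have fin := decreasing_profile_fin fdecr.
have uI : Num.sqrt (1 - u)%R \in `[0%R, 1%R[ by apply: itv_sqrt; rewrite u0 (le_trans uv).
have vI : Num.sqrt (1 - v)%R \in `[0%R, 1%R[ by apply: itv_sqrt; rewrite v1 (lt_le_trans u0).
have /andP[u1 u2] := fin _ uI; have /andP[v1' v2] := fin _ vI.
apply: fine_le; [by rewrite ge0_fin_numE// ltW|by rewrite ge0_fin_numE// ltW|].
by apply: fdecr => //; apply: ler_wsqrtr; lra.
Qed.

End monotone_profile.

Lemma increasing_equivalences (R : realType) (w : plane R -> \bar R) :
  weight w -> 0 < w (0%R, 0%R) < +oo -> increasing_weight w ->
    [<-> reverse_holder w;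
         reverse_jensen w;
         exists p : R, (1 < p)%R /\ B_class p w;
         B_infty w].
Proof.
move=> ww w0 [f wf fincr].
have fin := increasing_profile_fin ww wf w0 fincr.
pose g := depth_profile f.
have mg : measurable_fun (`]0%R, 1%R[%classic : set R) g := measurable_depth_profile wf.
have g_gt0 : forall u, (0 < u <= 1)%R -> (0 < g u)%R := depth_profile_gt0 fin.
have wE : forall z, disc R z -> w z = (g (depth z))%:E := profileE wf fin.
have ginc : forall u v, (0 < u)%R -> (u <= v)%R -> (v <= 1)%R -> (g v <= g u)%R :=
  depth_profile_noninc ww wf w0 fincr.
have muck2 : integrable_weight w -> forall K, (0 < K)%R -> mean_dominated g K ->
    mean_muckenhoupt g (2 - 1)^-1 K.
  move=> iw K K0 hK; have gi := integrable_profile mg g_gt0 wE iw.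
  rewrite (_ : (2 - 1)^-1 = 1)%R; last by field.
  exact: dominated_muckenhoupt hK.
tfae.
- move=> /(reverse_holderE mg wE)[iw [q [C [q1 C0 rh]]]].
  have gi := integrable_profile mg g_gt0 wE iw.
  have [K K0 hK] := reverse_holder_dominated mg g_gt0 gi ginc q1 C0 rh.
  apply/(reverse_jensenE mg g_gt0 wE); split=> //; exists K => //.
  apply: (muckenhoupt_reverse_jensen mg g_gt0 gi _ K0 (muck2 iw K K0 hK)).
  by rewrite invr_gt0; lra.
- move=> /(reverse_jensenE mg g_gt0 wE)[iw [C C0 rj]].
  have gi := integrable_profile mg g_gt0 wE iw.
  have [K K0 hK] := reverse_jensen_dominated mg g_gt0 gi ginc C0 rj.
  have p2 : (1 < (2 : R))%R by lra.
  exists 2%R; split=> //; apply/(B_classE mg wE p2); split=> //; exists K => //.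
  exact: muck2.
- move=> [p [p1 /(B_classE mg wE p1)[iw [C C0 bp]]]].
  have gi := integrable_profile mg g_gt0 wE iw.
  have s0 : (0 < (p - 1)^-1)%R by rewrite invr_gt0 subr_gt0.
  have rj := muckenhoupt_reverse_jensen mg g_gt0 gi s0 C0 bp.
  have [K K0 hK] := reverse_jensen_dominated mg g_gt0 gi ginc C0 rj.
  exact: (dominated_B_infty ww mg g_gt0 wE ginc iw K0 hK).
- move=> bi; have [iw _] := bi.
  have gi := integrable_profile mg g_gt0 wE iw.
  have [K K0 hK] := B_infty_dominated mg g_gt0 wE ginc bi.
  apply/(reverse_holderE mg wE); split=> //.
  exact: (dominated_reverse_holder mg g_gt0 gi ginc K0 hK).
Qed.

Lemma decreasing_equivalences (R : realType) (w : plane R -> \bar R) :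
  weight w -> 0 < w (0%R, 0%R) < +oo -> decreasing_weight w ->
    [<-> almost_constant_top_halves w;
         reverse_holder w;
         reverse_jensen w;
         exists p : R, (1 < p)%R /\ B_class p w].
Proof.
move=> ww w0 [f wf fdecr].
have fin := decreasing_profile_fin ww wf w0 fdecr.
pose g := depth_profile f.
have mg : measurable_fun (`]0%R, 1%R[%classic : set R) g := measurable_depth_profile wf.
have g_gt0 : forall u, (0 < u <= 1)%R -> (0 < g u)%R := depth_profile_gt0 fin.
have wE : forall z, disc R z -> w z = (g (depth z))%:E := profileE wf fin.
have gdec : forall u v, (0 < u)%R -> (u <= v)%R -> (v <= 1)%R -> (g u <= g v)%R :=
  depth_profile_nondec ww wf w0 fdecr.
have [iw gi] := nondecreasing_integrable ww mg g_gt0 wE gdec.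
tfae.
- move=> /(top_halves_doubling g_gt0 wE gdec)[K K1 hK].
  apply/(reverse_holderE mg wE); split=> //; exists 2%R, (2 * K)%R.
  split; [lra|lra|exact: doubling_reverse_holder hK].
- move=> /(reverse_holderE mg wE)[_ [q [C [q1 C0 rh]]]].
  have [K K1 hK] := reverse_holder_doubling mg g_gt0 gi gdec q1 C0 rh.
  have [s [C' [s0 C'0 mk]]] := doubling_muckenhoupt mg g_gt0 gi gdec K1 hK.
  apply/(reverse_jensenE mg g_gt0 wE); split=> //; exists C' => //.
  exact: (muckenhoupt_reverse_jensen mg g_gt0 gi s0 C'0 mk).
- move=> /(reverse_jensenE mg g_gt0 wE)[_ [C C0 rj]].
  have [K K1 hK] := reverse_jensen_doubling mg g_gt0 gi gdec C0 rj.
  have [s [C' [s0 C'0 mk]]] := doubling_muckenhoupt mg g_gt0 gi gdec K1 hK.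
  have p1 : (1 < s^-1 + 1)%R by rewrite ltrDr invr_gt0.
  exists (s^-1 + 1)%R; split=> //; apply/(B_classE mg wE p1); split=> //.
  by exists C' => //; rewrite addrK invrK.
- move=> [p [p1 /(B_classE mg wE p1)[_ [C C0 bp]]]].
  have s0 : (0 < (p - 1)^-1)%R by rewrite invr_gt0 subr_gt0.
  have rj := muckenhoupt_reverse_jensen mg g_gt0 gi s0 C0 bp.
  have [K K1 hK] := reverse_jensen_doubling mg g_gt0 gi gdec C0 rj.
  exact: (doubling_top_halves wE gdec K1 hK).
Qed.

Theorem corollary5p7 (R : realType) (w : plane R -> \bar R) :
  weight w -> 0 < w (0%R, 0%R) < +oo ->
  (increasing_weight w ->
    [<-> reverse_holder w;
         reverse_jensen w;
         exists p : R, (1 < p)%R /\ B_class p w;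
         B_infty w]) /\
  (decreasing_weight w ->
    [<-> almost_constant_top_halves w;
         reverse_holder w;
         reverse_jensen w;
         exists p : R, (1 < p)%R /\ B_class p w]).
Proof.
by move=> ww w0; split; [exact: increasing_equivalences|exact: decreasing_equivalences].
Qed.
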